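(* Suppose that for every $\delta<\omega$, the problem of detecting a triangle in a graph on $N$ vertices does not admit an $O(N^{\delta+o(1)})$-time algorithm. Then for every positive $\delta'<\omega$, $NDTIME(\lceil \tfrac12\log_2 n\rceil,\ n)\not\subseteq DTIME(n^{\delta'/2})$.
   Context: $\omega$ denotes the exponent of fast (square) matrix multiplication. $NDTIME(f(n),g(n))$ denotes the class of problems solvable in $O(g(n))$ time by a multi-tape Turing machine using an $f(n)$-bit non-deterministic oracle; $DTIME(g(n))=NDTIME(0,g(n))$. Algorithms in the hypothesis are RAM algorithms under the logarithmic cost model. *)

(* Defs.v *)
From HB Require Import structures.
From mathcomp Require Import all_boot all_order all_algebra.
From mathcomp Require Import all_classical all_reals all_analysis.

Set Implicit Arguments.
Unset Strict Implicit.
Unset Printing Implicit Defensive.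

Import Order.TTheory GRing.Theory Num.Theory numFieldNormedType.Exports.

Local Open Scope classical_set_scope.
Local Open Scope ring_scope.

Definition time_O (R : realType) (T : nat -> nat) (g : nat -> R) : Prop :=
  (fun n => (T n)%:R : R^o) =O_\oo (g : nat -> R^o).

(* Straight-line programs.  [SVar k] refers to the k-th value of the list made
   of the inputs followed by the results of the instructions already executed;
   constants of the field are available for free as operands. *)
Inductive slp_arg (F : Type) := SConst of F | SVar of nat.

Inductive slp_instr (F : Type) :=
  | SAdd of slp_arg F & slp_arg F
  | SSub of slp_arg F & slp_arg F
  | SMul of slp_arg F & slp_arg F.

Definition slp_arg_val (F : fieldType) (vals : seq F) (a : slp_arg F) : F :=
  match a with SConst c => c | SVar k => nth 0 vals k end.

Definition slp_instr_val (F : fieldType) (vals : seq F) (i : slp_instr F) : F :=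
  match i with
  | SAdd a b => slp_arg_val vals a + slp_arg_val vals b
  | SSub a b => slp_arg_val vals a - slp_arg_val vals b
  | SMul a b => slp_arg_val vals a * slp_arg_val vals b
  end.

Definition slp_eval (F : fieldType) (p : seq (slp_instr F)) (inputs : seq F) :
    seq F :=
  foldl (fun vals i => rcons vals (slp_instr_val vals i)) inputs p.

Definition mx_entries (F : Type) (n : nat) (A : 'M[F]_n) : seq F :=
  [seq A i j | i <- enum 'I_n, j <- enum 'I_n].

Definition slp_multiplies (F : fieldType) (n : nat) (p : seq (slp_instr F))
    (out : 'I_n -> 'I_n -> slp_arg F) : Prop :=
  forall (A B : 'M[F]_n) (i j : 'I_n),
    slp_arg_val (slp_eval p (mx_entries A ++ mx_entries B)) (out i j)
    = (A *m B) i j.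

(* Over an infinite field, computing the product for all matrices is the same
   as computing it for matrices of indeterminates. *)
Definition mxmul_ops_le (F : fieldType) (n c : nat) : Prop :=
  exists (p : seq (slp_instr F)) (out : 'I_n -> 'I_n -> slp_arg F),
    (size p <= c)%N /\ slp_multiplies p out.

(* The exponent depends only on the characteristic of the field; the rationals
   give the usual characteristic 0 value. *)
Definition omega (R : realType) : R :=
  inf [set tau : R | exists T : nat -> nat,
    (forall n : nat, mxmul_ops_le rat n (T n)) /\
    time_O T (fun n => n%:R `^ tau)].

Inductive move := MoveL | Stay | MoveR.

(* [tm_work] is the number of work tapes: the machine has [tm_work.+2] tapes,
   tape 0 initially holding the input and tape 1 the oracle bits.  Tapes are
   infinite to the right and all are two-way and read-write.  In the tape
   alphabet [option (bool + tm_sym)], [None] is the blank, and the symbols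
   [inl b] are the input and oracle bits. *)
Record tm := Tm {
  tm_work : nat;
  tm_state : finType;
  tm_sym : finType;
  tm_start : tm_state;
  tm_halt : pred tm_state;
  tm_accept : pred tm_state;
  tm_trans : tm_state -> {ffun 'I_tm_work.+2 -> option (bool + tm_sym)} ->
    tm_state * {ffun 'I_tm_work.+2 -> option (bool + tm_sym) * move} }.

Definition tm_letter (M : tm) : Type := option (bool + tm_sym M).

Record tm_config (M : tm) := TmConfig {
  tmc_state : tm_state M;
  tmc_head : 'I_(tm_work M).+2 -> nat;
  tmc_tape : 'I_(tm_work M).+2 -> nat -> tm_letter M }.

Definition tm_init (M : tm) (x w : seq bool) : tm_config M :=
  TmConfig (tm_start M) (fun=> 0%N)
    (fun k pos => omap inl (onth (nth [::] [:: x; w] k) pos)).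

(* A left move on the leftmost cell leaves the head in place. *)
Definition move_head (m : move) (pos : nat) : nat :=
  match m with MoveL => pos.-1 | Stay => pos | MoveR => pos.+1 end.

Definition tm_step (M : tm) (c : tm_config M) : tm_config M :=
  if tm_halt (tmc_state c) then c else
  let: (q, act) :=
    tm_trans (tmc_state c) [ffun k => tmc_tape c k (tmc_head c k)] in
  TmConfig q
    (fun k => move_head (act k).2 (tmc_head c k))
    (fun k => [eta tmc_tape c k with tmc_head c k |-> (act k).1]).

Definition tm_run (M : tm) (x w : seq bool) (t : nat) : tm_config M :=
  iter t (@tm_step M) (tm_init M x w).

Definition tm_halts_in (M : tm) (x w : seq bool) (t : nat) : Prop :=
  tm_halt (tmc_state (tm_run M x w t)).

Definition tm_accepts (M : tm) (x w : seq bool) : Prop :=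
  exists t : nat, tm_halts_in M x w t /\
    tm_accept (tmc_state (tm_run M x w t)).

Definition language := set (seq bool).

(* The time bound holds for every oracle string, and the oracle is the only
   source of non-determinism. *)
Definition NDTIME (R : realType) (f : nat -> nat) (g : nat -> R) :
    set language :=
  [set L : language | exists (M : tm) (T : nat -> nat),
    [/\ time_O T g,
        forall (x : seq bool) (w : (f (size x)).-tuple bool),
          tm_halts_in M x w (T (size x))
      & forall x : seq bool,
          L x <-> exists w : (f (size x)).-tuple bool, tm_accepts M x w]].

Definition DTIME (R : realType) (g : nat -> R) : set language :=
  NDTIME (fun=> 0%N) g.

(* The real number is nonnegative for n >= 1; for n = 0 it is 0, since
   [ln 0 = 0]. *)
Definition ceil_half_log2 (R : realType) (n : nat) : nat :=
  `|Num.ceil (2^-1 * (ln (n%:R : R) / ln 2))|%N.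

(* The machine of Aho, Hopcroft and Ullman: registers hold integers, register
   0 is the accumulator, and input and output are sequential tapes of integers.
   The operands [Imm v], [Dir i], [Ind i] are written =v, i and *i there. *)
Inductive ram_operand := Imm of int | Dir of nat | Ind of nat.

Inductive ram_instr :=
  | ILoad of ram_operand
  | IStore of ram_operand
  | IAdd of ram_operand
  | ISub of ram_operand
  | IMult of ram_operand
  | IDiv of ram_operand
  | IRead of ram_operand
  | IWrite of ram_operand
  | IJump of nat
  | IJgtz of nat
  | IJzero of nat
  | IHalt.

Record ram_config := RamConfig {
  rc_pc : nat;
  rc_mem : nat -> int;
  rc_in : seq int;
  rc_out : seq int }.

Definition ram_init (input : seq int) : ram_config :=
  RamConfig 0 (fun=> 0) input [::].

Definition ram_addr (mem : nat -> int) (a : ram_operand) : option nat :=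
  match a with
  | Imm _ => None
  | Dir i => Some i
  | Ind i => if mem i is Posz j then Some j else None
  end.

Definition ram_val (mem : nat -> int) (a : ram_operand) : option int :=
  if a is Imm v then Some v else omap mem (ram_addr mem a).

(* Division rounding towards minus infinity; [divz] rounds the other way when
   the divisor is negative. *)
Definition floordivz (m d : int) : int := ((sgz d * m) %/ `|d|)%Z.

Definition ram_arith (c : ram_config) (a : ram_operand)
    (op : int -> int -> option int) : option ram_config :=
  let: RamConfig pc mem inp out := c in
  if ram_val mem a is Some v then
    if op (mem 0%N) v is Some r then
      Some (RamConfig pc.+1 [eta mem with 0%N |-> r] inp out)
    else None
  else None.

Definition ram_jump (c : ram_config) (l : nat) (b : bool) : ram_config :=
  let: RamConfig pc mem inp out := c in
  RamConfig (if b then l else pc.+1) mem inp out.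

Definition ram_fetch (p : seq ram_instr) (c : ram_config) : ram_instr :=
  nth IHalt p (rc_pc c).

(* [None] means that the machine halts: on [IHalt], when leaving the program, or
   on an undefined instruction (negative address, division by zero, storing to
   a constant), which acts as [IHalt].  Reading past the end of the input
   yields 0. *)
Definition ram_next (p : seq ram_instr) (c : ram_config) : option ram_config :=
  let: RamConfig pc mem inp out := c in
  match ram_fetch p c with
  | ILoad a => ram_arith c a (fun _ v => Some v)
  | IAdd a => ram_arith c a (fun u v => Some (u + v))
  | ISub a => ram_arith c a (fun u v => Some (u - v))
  | IMult a => ram_arith c a (fun u v => Some (u * v))
  | IDiv a => ram_arith c a
      (fun u v => if v == 0 then None else Some (floordivz u v))
  | IStore a =>
      if ram_addr mem a is Some j then
        Some (RamConfig pc.+1 [eta mem with j |-> mem 0%N] inp out)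
      else None
  | IRead a =>
      if ram_addr mem a is Some j then
        Some (RamConfig pc.+1 [eta mem with j |-> head 0 inp] (behead inp) out)
      else None
  | IWrite a =>
      if ram_val mem a is Some v then
        Some (RamConfig pc.+1 mem inp (rcons out v))
      else None
  | IJump l => Some (ram_jump c l true)
  | IJgtz l => Some (ram_jump c l (0 < mem 0%N))
  | IJzero l => Some (ram_jump c l (mem 0%N == 0))
  | IHalt => None
  end.

(* l(z) = floor (log2 |z|) + 1 for z <> 0, and l(0) = 1. *)
Definition log_size (z : int) : nat := (trunc_log 2 `|z|%N).+1.

Definition addr_cost (mem : nat -> int) (a : ram_operand) : nat :=
  match a with
  | Imm _ => 0
  | Dir i => log_size i
  | Ind i => log_size i + log_size (mem i)
  end.

Definition operand_cost (mem : nat -> int) (a : ram_operand) : nat :=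
  (addr_cost mem a + (if ram_val mem a is Some v then log_size v else 0))%N.

Definition ram_cost (p : seq ram_instr) (c : ram_config) : nat :=
  let mem := rc_mem c in
  (match ram_fetch p c with
   | ILoad a | IWrite a => operand_cost mem a
   | IAdd a | ISub a | IMult a | IDiv a =>
       log_size (mem 0%N) + operand_cost mem a
   | IStore a => log_size (mem 0%N) + addr_cost mem a
   | IRead a => log_size (head 0%R (rc_in c)) + addr_cost mem a
   | IJgtz _ | IJzero _ => log_size (mem 0%N)
   | IJump _ | IHalt => 1
   end)%N.

(* [ram_run p c t out]: started in [c], the program halts after a computation
   of total logarithmic cost [t], with [out] on the output tape. *)
Inductive ram_run (p : seq ram_instr) : ram_config -> nat -> seq int -> Prop :=
  | RamHalt c : ram_next p c = None -> ram_run p c (ram_cost p c) (rc_out c)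
  | RamStep c c' t out : ram_next p c = Some c' -> ram_run p c' t out ->
      ram_run p c (ram_cost p c + t)%N out.

Definition simple_graph (N : nat) (e : rel 'I_N) : Prop :=
  symmetric e /\ irreflexive e.

Definition has_triangle (N : nat) (e : rel 'I_N) : Prop :=
  exists i j k : 'I_N, [&& e i j, e j k & e i k].

(* The number of vertices followed by the adjacency matrix, row by row. *)
Definition graph_input (N : nat) (e : rel 'I_N) : seq int :=
  N%:Z :: [seq (e i j : nat)%:Z | i <- enum 'I_N, j <- enum 'I_N].

(* The answer is "yes" when the first output symbol is 1. *)
Definition detects_triangle (p : seq ram_instr) (T : nat -> nat) : Prop :=
  forall (N : nat) (e : rel 'I_N), simple_graph e ->
    exists (t : nat) (out : seq int),
      [/\ ram_run p (ram_init (graph_input e)) t out,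
          (t <= T N)%N
        & ohead out = Some 1 <-> has_triangle e].

(* [eps] is the o(1) of the bound O(N^(delta + o(1))). *)
Definition triangle_in_time (R : realType) (delta : R) : Prop :=
  exists (p : seq ram_instr) (T : nat -> nat) (eps : nat -> R),
    [/\ detects_triangle p T,
        eps @ \oo --> 0
      & time_O T (fun N => N%:R `^ (delta + eps N))].

(* Main.v *)
Require Import Defs.
From mathcomp Require Import all_boot all_order all_algebra.
From mathcomp Require Import all_classical all_reals all_analysis.
From mathcomp Require Import zify ring lra.

(* If [delta' < 2], the words without 0 form a linear-time language which no
   machine decides in time O(n^(delta'/2)), since it could not read the whole
   input.  If [delta' >= 2], a graph on N vertices is coded by a word of length
   4N^2, a stream of two-bit instructions for a machine that reads its input once
   from left to right: 00 moves the oracle head while decrementing the oracle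
   string, 1b carries an entry of the adjacency matrix, 01 a diagonal entry.  Each
   row is N decrement steps followed by its N entries.  The row v at which the
   decrement underflows is copied on the work tape; in a later row j the copied
   entry in column j (the diagonal one) tells whether vj is an edge, and the other
   columns whether v and j have a common neighbour.  Hence the code of a graph is
   accepted for some oracle string iff the graph has a triangle.  A machine
   deciding these words in time O(n^(delta'/2)) could be run by a RAM that first
   writes the code of the input graph, for a total logarithmic cost
   O((N^2 + N^delta') log N) = O(N^delta) with delta' < delta < omega. *)

Set Implicit Arguments.
Unset Strict Implicit.
Unset Printing Implicit Defensive.

Import Order.TTheory GRing.Theory Num.Theory numFieldNormedType.Exports.
Local Open Scope classical_set_scope.
Local Open Scope ring_scope.

(** * Structured programs for the random access machine *)

(** The oracle has room for the name of one vertex v only, and time is linear, so the machine cannot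
    go back to row v of the matrix: the row has to be caught as it passes, and kept. Spotting it
    with a counter, and bringing two heads home before every row, must cost nothing beyond reading
    the input; hence the head moves are spelled out in the code itself. The N decrement steps of a
    row rewind the head on the copied row, and its N entries rewind the oracle head. Half the
    logarithm of the length 4N^2 exceeds log2 N, which gives enough bits for v.

    The language used is whatever this machine accepts; its behaviour on words that are not codes is
    harmless, since the RAM submits codes only.

    Writing the code takes quadratic time, so the reduction would give nothing below exponent 2 if
    omega were equal to 2. This is why delta' < 2 is settled by an unconditional lower bound. From 2
    on, the gap between delta' and omega pays for the logarithmic factor of the cost model. *)

(* Memory cell [i] of a command is register [i.+1] of the machine, so that the
   accumulator is invisible; accordingly a pointer to cell [i] is [i.+1]. *)
Inductive cmd :=
  | CSet of nat & int
  | CMov of nat & nat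
  | CAdd of nat & int
  | CLoad of nat & nat
  | CStore of nat & nat
  | CRead of nat
  | CWrite of int
  | CSkip
  | CSeq of cmd & cmd
  | CIf of nat & int & cmd & cmd
  | CWhile of nat & cmd.

Fixpoint csize (c : cmd) : nat :=
  match c with
  | CSet _ _ | CMov _ _ | CLoad _ _ | CStore _ _ => 2
  | CAdd _ _ => 3
  | CRead _ | CWrite _ => 1
  | CSkip => 0
  | CSeq c1 c2 => csize c1 + csize c2
  | CIf _ _ c1 c2 => 4 + csize c2 + csize c1
  | CWhile _ c => 3 + csize c
  end.

Fixpoint compile (c : cmd) (a : nat) : seq ram_instr :=
  match c with
  | CSet r z => [:: ILoad (Imm z); IStore (Dir r.+1)]
  | CMov r q => [:: ILoad (Dir q.+1); IStore (Dir r.+1)]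
  | CAdd r z => [:: ILoad (Dir r.+1); IAdd (Imm z); IStore (Dir r.+1)]
  | CLoad r q => [:: ILoad (Ind q.+1); IStore (Dir r.+1)]
  | CStore r q => [:: ILoad (Dir q.+1); IStore (Ind r.+1)]
  | CRead r => [:: IRead (Dir r.+1)]
  | CWrite z => [:: IWrite (Imm z)]
  | CSkip => [::]
  | CSeq c1 c2 => compile c1 a ++ compile c2 (a + csize c1)
  | CIf r z c1 c2 =>
      [:: ILoad (Dir r.+1); ISub (Imm z); IJzero (a + 4 + csize c2)]
        ++ compile c2 (a + 3)
        ++ IJump (a + (4 + csize c2 + csize c1)) :: compile c1 (a + 4 + csize c2)
  | CWhile r c =>
      [:: ILoad (Dir r.+1); IJzero (a + (3 + csize c))]
        ++ compile c (a + 2) ++ [:: IJump a]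
  end.

Lemma size_compile c a : size (compile c a) = csize c.
Proof.
by elim: c a => //= [c1 IH1 c2 IH2|_ _ c1 IH1 c2 IH2|_ c IH] a;
  rewrite ?size_cat /= ?size_cat /= ?IH1 ?IH2 ?IH; lia.
Qed.

Record store := Store { s_mem : nat -> int; s_in : seq int; s_out : seq int }.

Definition upd (s : store) (r : nat) (z : int) : store :=
  Store (fun i => if i == r then z else s_mem s i) (s_in s) (s_out s).

(* The weight dominates both the number of instructions executed and the
   increase of the largest absolute value in memory. *)
Inductive exec : cmd -> store -> nat -> store -> Prop :=
  | ESet s r z : exec (CSet r z) s (1 + r + `|z|) (upd s r z)
  | EMov s r q : exec (CMov r q) s (1 + r + q) (upd s r (s_mem s q))
  | EAdd s r z : exec (CAdd r z) s (1 + r + `|z|) (upd s r (s_mem s r + z))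
  | ELoad s r q i : s_mem s q = i.+1 ->
      exec (CLoad r q) s (1 + r + q) (upd s r (s_mem s i))
  | EStore s r q i : s_mem s r = i.+1 ->
      exec (CStore r q) s (1 + r + q) (upd s i (s_mem s q))
  | ERead s r : exec (CRead r) s (1 + r)
      (upd (Store (s_mem s) (behead (s_in s)) (s_out s)) r (head 0 (s_in s)))
  | EWrite s z : exec (CWrite z) s (1 + `|z|)
      (Store (s_mem s) (s_in s) (rcons (s_out s) z))
  | ESkip s : exec CSkip s 0 s
  | ESeq c1 c2 s n1 s1 n2 s2 : exec c1 s n1 s1 -> exec c2 s1 n2 s2 ->
      exec (CSeq c1 c2) s (n1 + n2) s2
  | EIfT r z c1 c2 s n s' : s_mem s r = z -> exec c1 s n s' ->
      exec (CIf r z c1 c2) s (1 + r + `|z| + n) s'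
  | EIfF r z c1 c2 s n s' : s_mem s r <> z -> exec c2 s n s' ->
      exec (CIf r z c1 c2) s (1 + r + `|z| + n) s'
  | EWhileF r c s : s_mem s r = 0 -> exec (CWhile r c) s (1 + r) s
  | EWhileT r c s n1 s1 n2 s2 : s_mem s r <> 0 -> exec c s n1 s1 ->
      exec (CWhile r c) s1 n2 s2 -> exec (CWhile r c) s (1 + r + n1 + n2) s2.

(** [ram_run] describes halting computations only, so a partial computation is expressed by its
    effect on them: every run from [c'] yields a run from [c] with the same output, dearer by at
    most [t]. *)
Definition reaches (p : seq ram_instr) (c : ram_config) (t : nat)
    (c' : ram_config) : Prop :=
  forall t' out, ram_run p c' t' out ->
    exists2 t'', (t'' <= t + t')%N & ram_run p c t'' out.

Lemma reaches_refl p c t : reaches p c t c.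
Proof. by move=> t' out h; exists t'; rewrite ?leq_addl. Qed.

Lemma reaches_trans p c1 t1 c2 t2 c3 t :
  reaches p c1 t1 c2 -> reaches p c2 t2 c3 -> (t1 + t2 <= t)%N ->
  reaches p c1 t c3.
Proof.
move=> h1 h2 ht t' out /h2[u hu /h1[v hv hr]]; exists v => //; lia.
Qed.

Lemma reaches_step p c c' t :
  ram_next p c = Some c' -> (ram_cost p c <= t)%N -> reaches p c t c'.
Proof.
by move=> h hc t' out hr; exists (ram_cost p c + t')%N;
  [rewrite leq_add2r | apply: RamStep hr].
Qed.

Definition code_at (p : seq ram_instr) (a : nat) (l : seq ram_instr) : Prop :=
  forall i, (i < size l)%N -> nth IHalt p (a + i) = nth IHalt l i.

Lemma code_at_cat p a l1 l2 : code_at p a (l1 ++ l2) ->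
  code_at p a l1 /\ code_at p (a + size l1) l2.
Proof.
move=> h; split=> i hi.
  by rewrite h ?nth_cat ?hi // size_cat; lia.
rewrite -addnA h ?nth_cat ?size_cat; last lia.
by case: ltnP => [|_]; [lia | rewrite addKn].
Qed.

Lemma code_at_cons p a i l : code_at p a (i :: l) ->
  nth IHalt p a = i /\ code_at p a.+1 l.
Proof.
rewrite -cat1s => /code_at_cat[h1 h2]; split; last by rewrite -addn1.
by move: (h1 0); rewrite addn0; apply.
Qed.

(** The pending input is bounded as well, since reading moves it into memory and its size enters the
    cost. *)
Definition store_le (B : nat) (s : store) : Prop :=
  (forall i, `|s_mem s i| <= B)%N /\ all (fun z : int => `|z| <= B)%N (s_in s).

Lemma store_leW B B' s : (B <= B')%N -> store_le B s -> store_le B' s.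
Proof.
move=> hB [h1 h2]; split=> [i|]; first exact: leq_trans (h1 i) hB.
by apply: sub_all h2 => z /leq_trans; apply.
Qed.

Lemma store_le_upd B s r z : store_le B s -> (`|z| <= B)%N ->
  store_le B (upd s r z).
Proof. by move=> [h1 h2] hz; split=> //= i; case: ifP. Qed.

Lemma leq_log_size (z : int) B : (`|z| <= B)%N -> (log_size z <= log_size B)%N.
Proof. by move=> h; rewrite ltnS; apply: leq_trunc_log. Qed.

Definition config (a : nat) (mem : nat -> int) (s : store) : ram_config :=
  RamConfig a mem (s_in s) (s_out s).

(** Register 0 is left out, so that commands are free to overwrite the accumulator. *)
Definition agree (mem : nat -> int) (s : store) : Prop :=
  forall i, mem i.+1 = s_mem s i.


Ltac scale := by rewrite ?addn0 -?mulnDl leq_mul2r; lia.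

Ltac ram1 h := apply: reaches_step;
  rewrite /ram_next /ram_cost /ram_fetch /= h /operand_cost /= ?addn1 ?addn2 ?addn3.

(** The weight exceeds every register index and constant named by the command, and bounds the growth
    of the stored values. Hence all integers met are bounded by [B'] and each instruction costs at
    most [3 * log_size B']. No command adds more than [7 * log_size B'] to the cost of its
    subcommands, so the factor 12 is generous. *)
Lemma exec_compile c s n s' : exec c s n s' ->
  forall p a B B' mem, code_at p a (compile c a) -> agree mem s ->
  store_le B s -> (B + n <= B')%N ->
  exists mem', [/\ reaches p (config a mem s) (12 * n * log_size B')
                     (config (a + csize c) mem' s'),
    agree mem' s' & store_le (B + n) s'].
Proof.
have ag0 (mem : nat -> int) u v : agree mem u -> agree [eta mem with 0%N |-> v] u.
  by move=> h i /=.
have agU (mem : nat -> int) r z u : agree mem u ->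
    agree [eta mem with r.+1 |-> z] (upd u r z).
  by move=> h i /=; rewrite eqSS; case: ifP => // _; apply: h.
have L0 B' : (0 < log_size B')%N by [].
have leA (r w B B' : nat) : (B + w <= B')%N -> (r < w)%N ->
    (log_size r.+1 <= log_size B')%N.
  by move=> h1 h2; apply: leq_log_size; rewrite absz_nat; lia.
have leV (z : int) (w B B' : nat) : (B + w <= B')%N -> (`|z| <= B + w)%N ->
    (log_size z <= log_size B')%N.
  by move=> h1 h2; apply: leq_log_size; lia.
elim=> {c s n s'}.
- move=> s r z p a B B' mem /code_at_cons[c1 /code_at_cons[c2 _]] ag sB hB.
  exists [eta [eta mem with 0%N |-> z] with r.+1 |-> z]; split.
  + have h1 := leA r _ _ _ hB; have h2 := leV z _ _ _ hB.
    apply: (@reaches_trans _ _ (2 * log_size B') _ (2 * log_size B')); last scale.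
      by ram1 c1 => //; lia.
    by ram1 c2 => //; lia.
  + exact/agU/ag0.
  + by apply: store_le_upd; [apply: store_leW sB | ]; lia.
- move=> s r q p a B B' mem /code_at_cons[c1 /code_at_cons[c2 _]] ag sB hB.
  have hq := sB.1 q.
  exists [eta [eta mem with 0%N |-> s_mem s q] with r.+1 |-> s_mem s q]; split.
  + have h1 := leA r _ _ _ hB; have h2 := leV (s_mem s q) _ _ _ hB.
    have h3 := leA q _ _ _ hB.
    apply: (@reaches_trans _ _ (2 * log_size B') _ (2 * log_size B')); last scale.
      by ram1 c1; rewrite ?ag //; lia.
    by ram1 c2 => //; lia.
  + exact/agU/ag0.
  + by apply: store_le_upd; [apply: store_leW sB | ]; lia.
- move=> s r z p a B B' mem
    /code_at_cons[c1 /code_at_cons[c2 /code_at_cons[c3 _]]] ag sB hB.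
  have hq := sB.1 r.
  exists [eta [eta [eta mem with 0%N |-> s_mem s r] with 0%N |-> s_mem s r + z]
           with r.+1 |-> s_mem s r + z]; split.
  + have h1 := leA r _ _ _ hB; have h2 := leV (s_mem s r) _ _ _ hB.
    have h3 := leV (s_mem s r + z) _ _ _ hB; have h4 := leV z _ _ _ hB.
    apply: (@reaches_trans _ _ (2 * log_size B') _ (4 * log_size B')); last scale.
      by ram1 c1; rewrite ?ag //; lia.
    apply: (@reaches_trans _ _ (2 * log_size B') _ (2 * log_size B')); last lia.
      by ram1 c2 => //; lia.
    by ram1 c3 => //; lia.
  + exact/agU/ag0/ag0.
  + by apply: store_le_upd; [apply: store_leW sB | ]; lia.
- move=> s r q i e p a B B' mem /code_at_cons[c1 /code_at_cons[c2 _]] ag sB hB.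
  have hq := sB.1 q; have hi := sB.1 i.
  exists [eta [eta mem with 0%N |-> s_mem s i] with r.+1 |-> s_mem s i]; split.
  + have h1 := leA r _ _ _ hB; have h2 := leV (s_mem s q) _ _ _ hB.
    have h3 := leA q _ _ _ hB; have h4 := leV (s_mem s i) _ _ _ hB.
    apply: (@reaches_trans _ _ (3 * log_size B') _ (2 * log_size B')); last scale.
      by ram1 c1; rewrite ag e /= ?ag // -e; lia.
    by ram1 c2; rewrite ?ag //; lia.
  + exact/agU/ag0.
  + by apply: store_le_upd; [apply: store_leW sB | ]; lia.
- move=> s r q i e p a B B' mem /code_at_cons[c1 /code_at_cons[c2 _]] ag sB hB.
  have hq := sB.1 q; have hr := sB.1 r.
  exists [eta [eta mem with 0%N |-> s_mem s q] with i.+1 |-> s_mem s q]; split.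
  + have h1 := leA r _ _ _ hB; have h2 := leV (s_mem s q) _ _ _ hB.
    have h3 := leA q _ _ _ hB; have h4 := leV (s_mem s r) _ _ _ hB.
    apply: (@reaches_trans _ _ (2 * log_size B') _ (3 * log_size B')); last scale.
      by ram1 c1; rewrite ?ag //; lia.
    by ram1 c2; rewrite ag e //= -e; lia.
  + exact/agU/ag0.
  + by apply: store_le_upd; [apply: store_leW sB | ]; lia.
- move=> s r p a B B' mem /code_at_cons[c1 _] ag sB hB.
  have hd : (`|head 0%R (s_in s)| <= B)%N.
    by case: sB => _; case: (s_in s) => //= z l /andP[].
  exists [eta mem with r.+1 |-> head 0 (s_in s)]; split.
  + have h1 := leA r _ _ _ hB; have h2 := leV (head 0 (s_in s)) _ _ _ hB.
    ram1 c1 => //; apply: (leq_trans (leq_add (h2 _) (h1 _))); [|lia|].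
      exact: leq_trans hd (leq_addr _ _).
    rewrite addnn -mul2n; scale.
  + exact: agU.
  + apply: store_le_upd; last exact: leq_trans hd (leq_addr _ _).
    split=> /= [i|]; first by have := sB.1 i; lia.
    have := (store_leW (leq_addr (1 + r) B) sB).2.
    by case: (s_in s) => //= z l /andP[].
- move=> s z p a B B' mem /code_at_cons[c1 _] ag sB hB; exists mem; split => //.
  + have h1 := leV z _ _ _ hB.
    ram1 c1 => //; apply: (@leq_trans (2 * log_size B')); first lia.
    scale.
  + by apply: (store_leW _ sB); lia.
- move=> s p a B B' mem _ ag sB hB; exists mem; split; rewrite /= ?addn0 //.
  exact: reaches_refl.
- move=> c1 c2 s n1 s1 n2 s2 _ IH1 _ IH2 p a B B' mem /= /code_at_cat[k1].
  rewrite size_compile => k2 ag sB hB.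
  have [|m1 [r1 ag1 sB1]] := IH1 p a B B' mem k1 ag sB; first lia.
  have [|m2 [r2 ag2 sB2]] := IH2 p _ _ B' _ k2 ag1 sB1; first lia.
  exists m2; split => //; last by rewrite addnA.
  by rewrite addnA; apply: (reaches_trans r1 r2); lia.
- move=> r z c1 c2 s n s' e _ IH p a B B' mem /= /code_at_cons[k1].
  move=> /code_at_cons[k2 /code_at_cons[k3 /code_at_cat[_]]].
  rewrite size_compile => /code_at_cons[_ k4] ag sB hB.
  have hr := sB.1 r.
  set mem1 := [eta [eta mem with 0%N |-> s_mem s r] with 0%N |-> s_mem s r - z].
  have h1 := leA r _ _ _ hB; have h2 := leV (s_mem s r) _ _ _ hB.
  have h3 := leV (s_mem s r - z) _ _ _ hB; have h4 := leV z _ _ _ hB.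
  have ek : (a.+3 + csize c2).+1 = (a + 4 + csize c2)%N by lia.
  rewrite ek in k4.
  have [||mem' [r1 ag1 sB1]] := IH p _ B B' mem1 k4 _ sB; [exact/ag0/ag0|lia|].
  exists mem'; split => //; last by apply: store_leW sB1; lia.
  rewrite (_ : a + _ = a + 4 + csize c2 + csize c1)%N; last lia.
  apply: (@reaches_trans _ _ (6 * log_size B')
    (config (a + 4 + csize c2) mem1 s) (12 * n * log_size B')); last scale.
    apply: (@reaches_trans _ _ (2 * log_size B')
      (config a.+1 [eta mem with 0%N |-> s_mem s r] s) (4 * log_size B'));
      last scale.
      by ram1 k1; rewrite ?ag //; lia.
    apply: (@reaches_trans _ _ (2 * log_size B') (config a.+2 mem1 s)
      (2 * log_size B')); last scale.
      by ram1 k2 => //; lia.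
    by ram1 k3; rewrite ?e ?subrr //=; lia.
  exact: r1.
- move=> r z c1 c2 s n s' e _ IH p a B B' mem /= /code_at_cons[k1].
  move=> /code_at_cons[k2 /code_at_cons[k3 /code_at_cat[k4]]].
  rewrite size_compile => /code_at_cons[k5 _] ag sB hB.
  have hr := sB.1 r.
  set mem1 := [eta [eta mem with 0%N |-> s_mem s r] with 0%N |-> s_mem s r - z].
  have h1 := leA r _ _ _ hB; have h2 := leV (s_mem s r) _ _ _ hB.
  have h3 := leV (s_mem s r - z) _ _ _ hB; have h4 := leV z _ _ _ hB.
  rewrite (_ : a.+3 = a + 3)%N in k4; last lia.
  have [||mem' [r1 ag1 sB1]] := IH p _ B B' mem1 k4 _ sB; [exact/ag0/ag0|lia|].
  exists mem'; split => //; last by apply: store_leW sB1; lia.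
  apply: (@reaches_trans _ _ (6 * log_size B') (config a.+3 mem1 s)
    (12 * n * log_size B' + 1 * log_size B')); last scale.
    apply: (@reaches_trans _ _ (2 * log_size B')
      (config a.+1 [eta mem with 0%N |-> s_mem s r] s) (4 * log_size B'));
      last scale.
      by ram1 k1; rewrite ?ag //; lia.
    apply: (@reaches_trans _ _ (2 * log_size B') (config a.+2 mem1 s)
      (2 * log_size B')); last scale.
      by ram1 k2 => //; lia.
    by ram1 k3; rewrite ?subr_eq0 ?(introF eqP e) //=; lia.
  rewrite addn3 in r1; apply: (reaches_trans r1); last exact: leqnn.
  by ram1 k5 => //; lia.
- move=> r c s e p a B B' mem /= /code_at_cons[k1].
  move=> /code_at_cons[k2 _] ag sB hB.
  have hr := sB.1 r.
  exists [eta mem with 0%N |-> s_mem s r]; split; first last.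
  + by apply: store_leW sB; lia.
  + exact: ag0.
  + have h1 := leA r _ _ _ hB; have h2 := leV (s_mem s r) _ _ _ hB.
    apply: (@reaches_trans _ _ (2 * log_size B') _ (2 * log_size B')); last scale.
      by ram1 k1; rewrite ?ag //; lia.
    by ram1 k2; rewrite ?e //; lia.
- move=> r c s n1 s1 n2 s2 e _ IH1 _ IH2 p a B B' mem k ag sB hB.
  have /= /code_at_cons[k1 /code_at_cons[k2]] := k.
  move=> /code_at_cat[k3]; rewrite size_compile => /code_at_cons[k4 _].
  have hr := sB.1 r.
  rewrite (_ : a.+2 = a + 2)%N in k3; last lia.
  set mem1 := [eta mem with 0%N |-> s_mem s r].
  have [||m1 [r1 ag1 sB1]] := IH1 p _ B B' mem1 k3 _ sB; [exact/ag0|lia|].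
  have [|m2 [r2 ag2 sB2]] := IH2 p _ _ B' _ k ag1 sB1; first lia.
  exists m2; split => //; last by apply: store_leW sB2; lia.
  have h1 := leA r _ _ _ hB; have h2 := leV (s_mem s r) _ _ _ hB.
  apply: (@reaches_trans _ _ (5 * log_size B' + 12 * n1 * log_size B') _
    (12 * n2 * log_size B')); [|exact: r2|scale].
  apply: (@reaches_trans _ _ (4 * log_size B') (config a.+2 mem1 s)
    (12 * n1 * log_size B' + 1 * log_size B')); [ | |lia].
    apply: (@reaches_trans _ _ (2 * log_size B') (config a.+1 mem1 s)
      (2 * log_size B')); last scale.
      by ram1 k1; rewrite ?ag //; lia.
    by ram1 k2; rewrite ?(introF eqP e) //; lia.
  rewrite addn2 in r1; apply: (reaches_trans r1); last exact: leqnn.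
  by ram1 k4 => //; lia.
Qed.

Lemma compile_run c inp n s B :
  exec c (Store (fun=> 0) inp [::]) n s ->
  all (fun z : int => `|z| <= B)%N inp ->
  exists2 t, (t <= 12 * n * log_size (B + n)%N + 1)%N &
    ram_run (compile c 0) (ram_init inp) t (s_out s).
Proof.
move=> /exec_compile h hB.
have := h (compile c 0) 0%N B (B + n)%N (fun=> 0).
case=> // mem' [r _ _].
(* Past its end the program fetches the default [IHalt], whose cost is the final [+ 1]. *)
have e : nth IHalt (compile c 0) (csize c) = IHalt.
  by rewrite nth_default // size_compile.
have h1 : ram_next (compile c 0) (config (0 + csize c) mem' s) = None.
  by rewrite /ram_next /ram_fetch /= add0n e.
have := RamHalt h1; rewrite {1}/ram_cost /ram_fetch /= add0n e => h2.
by have [t ht hr] := r _ _ h2; exists t.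
Qed.

(** * Total correctness with bounds on the weight *)

Fixpoint loop_free (c : cmd) : bool :=
  match c with
  | CSeq c1 c2 | CIf _ _ c1 c2 => loop_free c1 && loop_free c2
  | CWhile _ _ => false
  | _ => true
  end.

(** A static bound meant for loop-free commands; loops are charged by [wp_while]. *)
Fixpoint weight (c : cmd) : nat :=
  match c with
  | CSet r z | CAdd r z => 1 + r + `|z|
  | CMov r q | CLoad r q | CStore r q => 1 + r + q
  | CRead r => 1 + r
  | CWrite z => 1 + `|z|
  | CSkip => 0
  | CSeq c1 c2 => weight c1 + weight c2
  | CIf r z c1 c2 => 1 + r + `|z| + maxn (weight c1) (weight c2)
  | CWhile _ _ => 0
  end.

Lemma exec_weight c s n s' : exec c s n s' -> loop_free c -> (n <= weight c)%N.
Proof.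
elim=> //= {c s n s'}.
- by move=> c1 c2 s n1 s1 n2 s2 _ h1 _ h2 /andP[/h1 ? /h2 ?]; apply: leq_add.
- move=> r z c1 c2 s n s' _ _ h /andP[/h ? _].
  by rewrite leq_add2l leq_max; apply/orP; left.
- move=> r z c1 c2 s n s' _ _ h /andP[_ /h ?].
  by rewrite leq_add2l leq_max; apply/orP; right.
Qed.

Definition run (c : cmd) (Q : store -> Prop) (s : store) : Prop :=
  exists n s', exec c s n s' /\ Q s'.

Lemma run_post c (Q Q' : store -> Prop) s :
  (forall s', Q s' -> Q' s') -> run c Q s -> run c Q' s.
Proof. by move=> h [n [s' [? /h ?]]]; exists n, s'. Qed.

Lemma run_set r z (Q : store -> Prop) s : Q (upd s r z) -> run (CSet r z) Q s.
Proof. by exists (1 + r + `|z|)%N, (upd s r z); split=> //; apply: ESet. Qed.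

Lemma run_mov r q (Q : store -> Prop) s :
  Q (upd s r (s_mem s q)) -> run (CMov r q) Q s.
Proof. by eexists _, _; split; [apply: EMov|]. Qed.

Lemma run_add r z (Q : store -> Prop) s :
  Q (upd s r (s_mem s r + z)) -> run (CAdd r z) Q s.
Proof. by eexists _, _; split; [apply: EAdd|]. Qed.

Lemma run_load r q i (Q : store -> Prop) s : s_mem s q = i.+1 ->
  Q (upd s r (s_mem s i)) -> run (CLoad r q) Q s.
Proof. by move=> e; eexists _, _; split; [apply: ELoad e|]. Qed.

Lemma run_store r q i (Q : store -> Prop) s : s_mem s r = i.+1 ->
  Q (upd s i (s_mem s q)) -> run (CStore r q) Q s.
Proof. by move=> e; eexists _, _; split; [apply: EStore e|]. Qed.

Lemma run_skip (Q : store -> Prop) s : Q s -> run CSkip Q s.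
Proof. by eexists _, _; split; [apply: ESkip|]. Qed.

Lemma run_seq c1 c2 (Q : store -> Prop) s :
  run c1 (run c2 Q) s -> run (CSeq c1 c2) Q s.
Proof.
move=> [n1 [s1 [h1 [n2 [s2 [h2 q]]]]]].
by eexists _, _; split; [apply: ESeq h1 h2|].
Qed.

Lemma run_if r z c1 c2 (Q : store -> Prop) s :
  run (if s_mem s r == z then c1 else c2) Q s -> run (CIf r z c1 c2) Q s.
Proof.
by case: eqP => e [n [s' [h q]]]; eexists _, _; split; [
  apply: EIfT h | | apply: EIfF h |].
Qed.

Fixpoint cseqs (cs : seq cmd) : cmd :=
  if cs is c :: cs' then CSeq c (cseqs cs') else CSkip.

Lemma loop_free_cseqs cs : loop_free (cseqs cs) = all loop_free cs.
Proof. by elim: cs => //= c cs ->. Qed.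

(** The invariant is indexed by the keys already processed. Uniqueness makes the next key fresh, so
    that a step may assume, for instance, that its tape has not been updated yet. *)
Lemma run_cseqs (T : eqType) (f : T -> cmd) (I : seq T -> store -> Prop)
    (ks : seq T) s :
  (forall l k s, uniq (rcons l k) -> I l s -> run (f k) (I (rcons l k)) s) ->
  uniq ks -> I [::] s -> run (cseqs (map f ks)) (I ks) s.
Proof.
move=> hf us hs.
suff H l l' s' : uniq (l ++ l') -> I l s' ->
    run (cseqs (map f l')) (I (l ++ l')) s' by exact: (H [::]).
elim: l' l s' => [|k l' IH] l s' u h /=; first by rewrite cats0; apply: run_skip.
apply: run_seq; rewrite -cat_rcons in u *.
apply: run_post (hf _ _ _ _ h) => [s2|]; first exact: IH.
by move: u; rewrite cat_uniq => /and3P[].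
Qed.

Definition wp (c : cmd) (n : nat) (Q : store -> Prop) (s : store) : Prop :=
  exists n' s', [/\ exec c s n' s', (n' <= n)%N & Q s'].

Lemma wp_run c (Q : store -> Prop) s :
  loop_free c -> run c Q s -> wp c (weight c) Q s.
Proof.
by move=> lf [n [s' [h q]]]; exists n, s'; rewrite (exec_weight h).
Qed.

Lemma wp_post c (n n' : nat) (Q Q' : store -> Prop) s :
  (n <= n')%N -> (forall s', Q s' -> Q' s') -> wp c n Q s -> wp c n' Q' s.
Proof.
move=> hn hQ [m [s' [? ? ?]]]; exists m, s'; split; [by []| |exact: hQ].
exact: leq_trans hn.
Qed.

Lemma wp_seq c1 c2 n1 n2 (Q : store -> Prop) s :
  wp c1 n1 (wp c2 n2 Q) s -> wp (CSeq c1 c2) (n1 + n2) Q s.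
Proof.
move=> [m1 [s1 [h1 l1 [m2 [s2 [h2 l2 q]]]]]].
by exists (m1 + m2)%N, s2; rewrite leq_add //; split=> //; apply: ESeq h1 h2.
Qed.

(** [k] bounds the iterations still to come: a nonzero guard must leave room for one more, which
    gives termination. The last summand of the bound pays for the final test. *)
Lemma wp_while r c b (I : nat -> store -> Prop) k s :
  (forall k s, I k s -> s_mem s r <> 0 ->
    exists k', k = k'.+1 /\ wp c b (I k') s) ->
  I k s ->
  wp (CWhile r c) (k * (1 + r + b) + (1 + r))
    (fun s' => s_mem s' r = 0 /\ exists k', I k' s') s.
Proof.
move=> hI; elim/ltn_ind: k s => k IH s hk.
have [e|e] := eqVneq (s_mem s r) 0.
  exists (1 + r)%N, s; rewrite leq_addl.
  by split; [apply: EWhileF | | split=> //; exists k].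
have [k' [ek [n1 [s1 [h1 l1 q1]]]]] := hI _ _ hk (elimN eqP e).
have [|n2 [s2 [h2 l2 q2]]] := IH k' _ s1 q1; first by rewrite ek.
exists (1 + r + n1 + n2)%N, s2; split=> //.
  by apply: EWhileT h1 h2; apply/eqP.
by rewrite ek mulSn; lia.
Qed.

Lemma run_read r (Q : store -> Prop) s :
  Q (upd (Store (s_mem s) (behead (s_in s)) (s_out s)) r (head 0 (s_in s))) ->
  run (CRead r) Q s.
Proof. by eexists _, _; split; [apply: ERead|]. Qed.

Lemma run_write z (Q : store -> Prop) s :
  Q (Store (s_mem s) (s_in s) (rcons (s_out s) z)) -> run (CWrite z) Q s.
Proof. by eexists _, _; split; [apply: EWrite|]. Qed.

(** * Simulating a Turing machine step *)

(* Cells [k] and [tapes M + k] hold the address of the head of tape [k] and the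
   letter under it; the other registers follow, then the tapes, interleaved. *)
Definition tapes (M : tm) : nat := (tm_work M).+2.
Definition rLet (M : tm) (k : nat) : nat := tapes M + k.
Definition rCur (M : tm) : nat := 2 * tapes M.
Definition rNew (M : tm) : nat := (2 * tapes M).+1.
Definition rBusy (M : tm) : nat := (2 * tapes M).+2.
Definition rTmp (M : tm) : nat := (2 * tapes M).+3.
Definition rUser (M : tm) (i : nat) : nat := 2 * tapes M + 4 + i.
Definition cell (M : tm) (k pos : nat) : nat := 2 * tapes M + 11 + (pos * tapes M + k).

(** Position and tape are quotient and remainder modulo the number of tapes. The base of [cell]
    skips two blocks of [tapes M] registers, four control registers and seven user registers. *)
Lemma cell_inj (M : tm) (k k' : 'I_(tapes M)) pos pos' :
  (cell M k pos == cell M k' pos') = (k == k') && (pos == pos').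
Proof.
rewrite eqn_add2l; apply/eqP/andP => [e|[/eqP-> /eqP->]//].
have h (i : 'I_(tapes M)) (p : nat) : ((p * tapes M + i) %/ tapes M)%N = p.
  by rewrite divnMDl ?divn_small ?addn0.
have ep : pos = pos' by rewrite -(h k pos) e h.
have ek : k = k' by apply: val_inj; apply: (@addnI (pos' * tapes M)); rewrite -e ep.
by rewrite ep ek.
Qed.

(** The blank is 0 because untouched memory is 0: the infinitely many blank cells need no
    initialisation. *)
Definition letter_code (M : tm) (l : tm_letter M) : int :=
  if l is Some x then (enum_rank x).+1%:Z else 0.

Lemma letter_code_inj (M : tm) : injective (@letter_code M).
Proof. by move=> [x|] [y|] //= [] e; congr Some; apply/enum_rank_inj/val_inj. Qed.

Definition state_code (M : tm) (q : tm_state M) : int := (enum_rank q : nat)%:Z.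

Lemma state_code_inj (M : tm) : injective (@state_code M).
Proof. by move=> x y [] e; apply/enum_rank_inj/val_inj. Qed.

(** A left move first compares the head with the leftmost address and does nothing there, in
    accordance with [move_head]. *)
Definition act_cmd (M : tm) (k : nat) (act : tm_letter M * move) : cmd :=
  CSeq (CSet (rTmp M) (letter_code act.1))
    (CSeq (CStore k (rTmp M))
      (match act.2 with
       | MoveL => CIf k (cell M k 0).+1%:Z CSkip (CAdd k (- (tapes M)%:Z))
       | Stay => CSkip
       | MoveR => CAdd k (tapes M)%:Z
       end)).

Definition holds_tape (M : tm) (s : store) (k head : nat)
    (tape : nat -> tm_letter M) : Prop :=
  s_mem s k = (cell M k head).+1%:Z /\
  forall pos, s_mem s (cell M k pos) = letter_code (tape pos).

Lemma run_act (M : tm) (k : 'I_(tapes M)) (act : tm_letter M * move) s head tape :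
  holds_tape s k head tape ->
  run (act_cmd k act) (fun s' =>
    [/\ holds_tape s' k (move_head act.2 head)
          [eta tape with head |-> act.1],
        forall i, i != k :> nat -> i != rTmp M ->
          (forall pos, i != cell M k pos) -> s_mem s' i = s_mem s i,
        s_in s' = s_in s & s_out s' = s_out s]) s.
Proof.
case: act => [l m] [hp ht]; have hk := ltn_ord k.
have cT pos : (cell M k pos == rTmp M) = false by rewrite /cell /rTmp; lia.
have ck pos : (cell M k pos == k) = false by rewrite /cell; lia.
have kc pos : (k == cell M k pos :> nat) = false by rewrite /cell; lia.
have kT : (k == rTmp M :> nat) = false by rewrite /rTmp; lia.
set s1 := upd (upd s (rTmp M) (letter_code l)) (cell M k head) (letter_code l).
have h1 : s_mem s1 k = (cell M k head).+1%:Z by rewrite /= kc kT.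
have h2 pos : s_mem s1 (cell M k pos) =
    letter_code ([eta tape with head |-> l] pos).
  by rewrite /= cell_inj eqxx /=; case: ifP => //; rewrite cT ht.
have h3 i : i != k :> nat -> i != rTmp M ->
    (forall pos, i != cell M k pos) -> s_mem s1 i = s_mem s i.
  by move=> _ h4 h5; rewrite /= (negbTE (h5 _)) (negbTE h4).
apply: run_seq; apply: run_set; apply: run_seq.
apply: (@run_store _ _ (cell M k head)); rewrite /= ?kT //.
rewrite eqxx -/s1.
suff H z : s_mem s1 k + z = (cell M k (move_head m head)).+1%:Z ->
    forall s2, s2 = upd s1 k (s_mem s1 k + z) ->
    [/\ holds_tape s2 k (move_head m head) [eta tape with head |-> l],
        forall i, i != k :> nat -> i != rTmp M ->
          (forall pos, i != cell M k pos) -> s_mem s2 i = s_mem s i,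
        s_in s2 = s_in s & s_out s2 = s_out s].
  case: m H => H.
  - apply: run_if; case: eqP => e.
    + apply: run_skip; split=> //; split=> //.
      rewrite e /= in h1 *; move: h1; rewrite /cell => -[] h1.
      by rewrite (_ : head.-1 = 0%N) //; nia.
    + apply: run_add; apply: (H _ _ _ (erefl _)); rewrite h1 /cell /=.
      move: e; rewrite h1 /cell; case: (head) => [|hd] //= _; lia.
  - by apply: run_skip; split=> //; split.
  - apply: run_add; apply: (H _ _ _ (erefl _)).
    by rewrite h1 /cell /=; lia.
move=> e s2 ->; split=> //.
- split=> [|pos]; first by rewrite /= eqxx e.
  by rewrite -h2 [LHS]/= ck.
- by move=> i i1 i2 i3; rewrite -h3 //= (negbTE i1).
Qed.

Definition view (M : tm) : Type := {ffun 'I_(tapes M) -> tm_letter M}.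

Definition apply_cmd (M : tm) (q : tm_state M)
    (act : {ffun 'I_(tapes M) -> tm_letter M * move}) : cmd :=
  CSeq (CSet (rNew M) (state_code q))
    (CSeq (CSet (rBusy M) (~~ tm_halt q)%:Z)
      (cseqs [seq act_cmd k (act k) | k : 'I_(tapes M) <- enum 'I_(tapes M)])).

Definition guard_cmd (M : tm) (a : view M) (ks : seq 'I_(tapes M)) (c : cmd) : cmd :=
  foldr (fun (k : 'I_(tapes M)) c => CIf (rLet M k) (letter_code (a k)) c CSkip) c ks.

Definition rule_cmd (M : tm) (x : tm_state M * view M) : cmd :=
  CIf (rCur M) (state_code x.1)
    (guard_cmd x.2 (enum 'I_(tapes M))
      (let: (q, act) := tm_trans x.1 x.2 in apply_cmd q act)) CSkip.

(** All rules are tried in turn. They consult copies of the scanned letters, and the new state waits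
    in [rNew] until the end: once a rule has fired, the later ones still see the old state and
    letters, and stay silent. *)
Definition step_cmd (M : tm) : cmd :=
  CSeq (cseqs [seq CLoad (rLet M k) k | k : 'I_(tapes M) <- enum 'I_(tapes M)])
    (CSeq (cseqs [seq rule_cmd x |
             x <- enum {: tm_state M * {ffun 'I_(tapes M) -> tm_letter M}}])
      (CMov (rCur M) (rNew M))).

Lemma loop_free_step (M : tm) : loop_free (step_cmd M).
Proof.
rewrite /= !loop_free_cseqs !all_map !andbT; apply/andP; split; apply/allP => //=.
move=> [q a] _; rewrite /= andbT; elim: (enum _) => [|k ks IH] /=; last by rewrite IH.
case: tm_trans => q' act /=; rewrite loop_free_cseqs all_map; apply/allP => k _ /=.
by case: (act k).2.
Qed.

(** The registers that updating a tape leaves alone; [rTmp] is excluded, since [act_cmd] puts the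
    letter to be written there. *)
Definition is_ctrl (M : tm) (i : nat) : Prop :=
  (tapes M <= i)%N /\ (i < rTmp M)%N.

Lemma ctrl_cell (M : tm) i (k : 'I_(tapes M)) pos :
  is_ctrl M i -> (i == cell M k pos) = false.
Proof. by rewrite /is_ctrl /rTmp /cell; lia. Qed.

Lemma ctrl_head (M : tm) i (k : 'I_(tapes M)) :
  is_ctrl M i -> (i == k :> nat) = false.
Proof. by have := ltn_ord k; rewrite /is_ctrl; lia. Qed.

Lemma ctrlE (M : tm) : [/\ forall k : 'I_(tapes M), is_ctrl M (rLet M k),
  is_ctrl M (rCur M), is_ctrl M (rNew M) & is_ctrl M (rBusy M)].
Proof.
by rewrite /is_ctrl /rLet /rCur /rNew /rBusy /rTmp; split=> [k|||];
  try have := ltn_ord k; lia.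
Qed.

Lemma holds_tape_upd (M : tm) s (k : 'I_(tapes M)) head (tape : nat -> tm_letter M) i z :
  is_ctrl M i -> holds_tape s k head tape -> holds_tape (upd s i z) k head tape.
Proof.
move=> hi [h1 h2]; split=> [|pos]; first by rewrite /= eq_sym ctrl_head.
by rewrite /= eq_sym ctrl_cell.
Qed.

Lemma run_apply (M : tm) (c : tm_config M) q act s :
  (forall k : 'I_(tapes M), holds_tape s k (tmc_head c k) (tmc_tape c k)) ->
  run (apply_cmd q act) (fun s' =>
    [/\ forall k : 'I_(tapes M),
                holds_tape s' k (move_head (act k).2 (tmc_head c k))
          [eta tmc_tape c k with tmc_head c k |-> (act k).1],
        s_mem s' (rNew M) = state_code q,
        s_mem s' (rBusy M) = (~~ tm_halt q)%:Z,
        forall i, is_ctrl M i -> i != rNew M -> i != rBusy M ->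
          s_mem s' i = s_mem s i &
        s_in s' = s_in s /\ s_out s' = s_out s]) s.
Proof.
move=> hc; have [_ _ cN cB] := ctrlE M.
apply: run_seq; apply: run_set; apply: run_seq; apply: run_set.
set s1 := upd _ _ _.
pose I (l : seq 'I_(tapes M)) s' :=
  [/\ forall k, if k \in l then holds_tape s' k (move_head (act k).2 (tmc_head c k))
          [eta tmc_tape c k with tmc_head c k |-> (act k).1]
        else holds_tape s' k (tmc_head c k) (tmc_tape c k),
      forall i, is_ctrl M i -> s_mem s' i = s_mem s1 i,
      s_in s' = s_in s & s_out s' = s_out s].
apply: run_post (run_cseqs (I := I) _ (enum_uniq _) _) => [s' [h1 h2 h3 h4]||].
- split=> //.
  + by move=> k; have := h1 k; rewrite mem_enum.
  + rewrite h2 //= eqxx; case: eqP => //; rewrite /rNew /rBusy; lia.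
  + by rewrite h2 //= eqxx.
  + by move=> i i1 i2 i3; rewrite h2 //= (negbTE i2) (negbTE i3).
- move=> l k s2; rewrite rcons_uniq => /andP[kl _] [h1 h2 h3 h4].
  have := h1 k; rewrite (negbTE kl) => /(run_act (act k)).
  apply: run_post => s3 [h5 h6 h7 h8]; split=> [k'|i ci||]; last 2 first.
  + by rewrite h7.
  + by rewrite h8.
  + rewrite mem_rcons inE; case: eqVneq => [->//|nk] /=.
    have := h1 k'; have e1 : s_mem s3 k' = s_mem s2 k'.
      apply: h6 => [||pos]; rewrite ?(inj_eq val_inj) // /rTmp ?/cell;
        have := ltn_ord k'; lia.
    have e2 pos : s_mem s3 (cell M k' pos) = s_mem s2 (cell M k' pos).
      apply: h6 => [||pos']; rewrite ?cell_inj ?(negbTE nk) // /rTmp ?/cell;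
        have := ltn_ord k; lia.
    by case: ifP => _ [u1 u2]; split=> [|pos]; rewrite ?e1 ?e2.
  + rewrite h6 ?h2 //; [by rewrite ctrl_head| |by move=> pos; rewrite ctrl_cell].
    by move: ci; rewrite /is_ctrl; lia.
- by split=> // k; do 2 apply: holds_tape_upd => //; exact: hc.
Qed.

Lemma run_guard (M : tm) (a b : view M) (ks : seq 'I_(tapes M)) c Q s :
  (forall k : 'I_(tapes M), s_mem s (rLet M k) = letter_code (a k)) ->
  (forall k, k \in ks -> a k = b k) -> run c Q s -> run (guard_cmd b ks c) Q s.
Proof.
move=> ha; elim: ks => //= k ks IH hk h; apply: run_if.
rewrite ha hk ?mem_head // eqxx; apply: IH => // i hi.
by apply: hk; rewrite inE hi orbT.
Qed.

Lemma run_guard_skip (M : tm) (a b : view M) (ks : seq 'I_(tapes M)) c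
    (Q : store -> Prop) s k :
  (forall k : 'I_(tapes M), s_mem s (rLet M k) = letter_code (a k)) ->
  k \in ks -> a k <> b k -> Q s -> run (guard_cmd b ks c) Q s.
Proof.
move=> ha; elim: ks => //= k' ks IH hk ne q; apply: run_if; rewrite ha.
case: eqP => [/letter_code_inj e|_]; last exact: run_skip.
apply: IH => //; move: hk; rewrite inE => /orP[/eqP kk|//].
by case: ne; rewrite kk.
Qed.

Definition holds (M : tm) (c : tm_config M) (s : store) : Prop :=
  [/\ forall k : 'I_(tapes M), holds_tape s k (tmc_head c k) (tmc_tape c k),
      s_mem s (rCur M) = state_code (tmc_state c) &
      s_mem s (rBusy M) = (~~ tm_halt (tmc_state c))%:Z].

Lemma run_step (M : tm) (c : tm_config M) s :
  ~~ tm_halt (tmc_state c) -> holds c s ->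
  run (step_cmd M) (fun s' =>
    [/\ holds (tm_step c) s', s_in s' = s_in s & s_out s' = s_out s]) s.
Proof.
move=> nh [ht hq hb]; have [cL cC cN cB] := ctrlE M.
pose a : view M := [ffun k => tmc_tape c k (tmc_head c k)].
pose I1 (l : seq 'I_(tapes M)) s' :=
  [/\ forall k : 'I_(tapes M), holds_tape s' k (tmc_head c k) (tmc_tape c k),
      s_mem s' (rCur M) = state_code (tmc_state c),
      forall k, k \in l -> s_mem s' (rLet M k) = letter_code (a k),
      s_in s' = s_in s & s_out s' = s_out s].
apply: run_seq.
apply: run_post (run_cseqs (I := I1) _ (enum_uniq _) _) => [s1 [t1 q1 l1 i1 o1]||];
  last by split.
- have {}l1 (k : 'I_(tapes M)) : s_mem s1 (rLet M k) = letter_code (a k).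
    by apply: l1; rewrite mem_enum.
  case et: (tm_trans (tmc_state c) a) => [q act].
  (* [l] lists the rules already tried; the update has taken place exactly when the applicable rule
     is among them. Codes being injective, there is only one such rule. *)
  pose I2 (l : seq (tm_state M * {ffun 'I_(tapes M) -> tm_letter M})) s' :=
    [/\ if (tmc_state c, a) \in l then
          [/\ forall k : 'I_(tapes M),
                holds_tape s' k (move_head (act k).2 (tmc_head c k))
                [eta tmc_tape c k with tmc_head c k |-> (act k).1],
              s_mem s' (rNew M) = state_code q &
              s_mem s' (rBusy M) = (~~ tm_halt q)%:Z]
        else forall k : 'I_(tapes M), holds_tape s' k (tmc_head c k) (tmc_tape c k),
        s_mem s' (rCur M) = state_code (tmc_state c),
        forall k : 'I_(tapes M), s_mem s' (rLet M k) = letter_code (a k),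
        s_in s' = s_in s & s_out s' = s_out s].
  apply: run_seq.
  apply: run_post (run_cseqs (I := I2) _ (enum_uniq _) _) => [s2||]; last by split.
  + rewrite /I2 mem_enum inE => -[[h1 h2 h3] h4 h5 h6 h7]; apply: run_mov.
    split=> //; rewrite /tm_step (negbTE nh) -/a et; split=> [k||] /=.
    * by apply: holds_tape_upd => //; exact: h1.
    * by rewrite eqxx.
    * by rewrite -h3; case: eqP => //; rewrite /rCur /rBusy; lia.
  + move=> l [q' b] s2; rewrite rcons_uniq => /andP[nl _] [h1 h4 h5 h6 h7].
    apply: run_if; rewrite h4 /=; case: eqP => [/state_code_inj eq'|nq]; last first.
      apply: run_skip; split=> //; rewrite mem_rcons inE xpair_eqE.
      by rewrite (introF eqP) // => e; case: nq; rewrite e.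
    have [eb|nb] := eqVneq a b.
      subst b q'; rewrite (negbTE nl) in h1.
      apply: (run_guard h5) => //; rewrite et.
      apply: run_post (run_apply q act h1) => s3 [g1 g2 g3 g4 [g5 g6]].
      split; rewrite ?g5 ?g6 //.
      * by rewrite mem_rcons mem_head.
      * by rewrite g4 //; rewrite /rCur /rNew /rBusy; lia.
      * move=> k; rewrite g4 //; have := ltn_ord k;
          rewrite /rLet /rNew /rBusy; lia.
    have [k nk] : exists k, a k <> b k.
      apply/existsNP => e; case/negP: nb; apply/eqP/ffunP => k; exact: e.
    have mk : k \in enum 'I_(tapes M) by rewrite mem_enum.
    have := @run_guard_skip M a b _ _ _ _ _ h5 mk nk. apply.
    split=> //; rewrite mem_rcons inE xpair_eqE (negbTE nb) andbF /=.
    exact: h1.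
- move=> l k s1 _ [t1 q1 l1 i1 o1]; have [p1 p2] := t1 k.
  apply: run_load p1 _; split=> //.
  + by move=> k'; apply: holds_tape_upd => //; exact: t1.
  + by rewrite /= -q1; case: eqP => //; have := ltn_ord k; rewrite /rLet /rCur; lia.
  + move=> k'; rewrite mem_rcons inE /= eqn_add2l (inj_eq val_inj).
    by case: eqVneq => [-> _|_ /l1//]; rewrite p2 ffunE.
Qed.

(** * Writing the code of a graph on the input tape *)

(** The loop leaves at the first halting configuration, possibly before time [T]; after [t]
    iterations the invariant allows [T - t] more. *)
Lemma wp_simulate (M : tm) x w T s :
  tm_halts_in M x w T -> holds (tm_init M x w) s ->
  wp (CWhile (rBusy M) (step_cmd M))
    (T * (1 + rBusy M + weight (step_cmd M)) + (1 + rBusy M))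
    (fun s' => exists t, [/\ tm_halts_in M x w t, holds (tm_run M x w t) s' &
       s_out s' = s_out s]) s.
Proof.
move=> hT h0.
pose I k s' := exists t, [/\ (t + k)%N = T, holds (tm_run M x w t) s' &
  s_out s' = s_out s].
apply: wp_post (leqnn _) _ (wp_while (I := I) _ (_ : I T s)).
- move=> s' [e [k [t [_ ht os]]]]; exists t; split=> //.
  by case: ht => _ _; rewrite e /tm_halts_in; case: tm_halt.
- move=> k s' [t [tk ht os]] busy.
  have nh : ~~ tm_halt (tmc_state (tm_run M x w t)).
    by case: ht => _ _ hb; apply/negP => hh; case: busy; rewrite hb hh.
  case: k tk => [|k] tk; first by move: nh; rewrite (_ : t = T) ?hT //; lia.
  exists k; split=> //; apply: wp_run; first exact: loop_free_step.
  apply: run_post (run_step nh ht) => s2 [h2 _ o2].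
  by exists t.+1; split; [lia|exact: h2|rewrite o2].
- by exists 0%N; split.
Qed.

Definition answer_cmd (M : tm) : cmd :=
  cseqs [seq CIf (rCur M) (state_code q) (CWrite (tm_accept q : nat)%:Z) CSkip
        | q <- enum (tm_state M)].

Lemma loop_free_answer (M : tm) : loop_free (answer_cmd M).
Proof. by rewrite loop_free_cseqs all_map; apply/allP. Qed.

Lemma run_answer (M : tm) (q : tm_state M) s :
  s_mem s (rCur M) = state_code q -> s_out s = [::] ->
  run (answer_cmd M) (fun s' => s_out s' = [:: (tm_accept q : nat)%:Z]) s.
Proof.
move=> hq ho.
pose I (l : seq (tm_state M)) s' := s_mem s' (rCur M) = state_code q /\
  s_out s' = if q \in l then [:: (tm_accept q : nat)%:Z] else [::].
apply: run_post (run_cseqs (I := I) _ (enum_uniq _) _) => [s' [_]||].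
- by rewrite mem_enum.
- move=> l q' s1; rewrite rcons_uniq => /andP[nl _] [h1 h2].
  apply: run_if; rewrite h1; case: eqP => [/state_code_inj e|ne].
    subst q'; apply: run_write; split=> //=.
    by rewrite h2 (negbTE nl) mem_rcons mem_head.
  apply: run_skip; split=> //; rewrite mem_rcons inE.
  by case: eqVneq => // e; case: ne; rewrite e.
- by [].
Qed.

Definition setup_cmd (M : tm) : cmd :=
  CSeq (cseqs [seq CSet k (cell M k 0).+1%:Z | k : 'I_(tapes M) <- enum 'I_(tapes M)])
    (CSeq (CSet (rCur M) (state_code (tm_start M)))
      (CSet (rBusy M) (~~ tm_halt (tm_start M))%:Z)).

Lemma loop_free_setup (M : tm) : loop_free (setup_cmd M).
Proof. by rewrite /= loop_free_cseqs all_map andbT; apply/allP. Qed.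

Definition input_cells (M : tm) (x : seq bool) (s : store) : Prop :=
  forall (k : 'I_(tapes M)) pos, s_mem s (cell M k pos) =
    letter_code (omap inl (onth (nth [::] [:: x; [::]] k) pos) : tm_letter M).

Lemma run_setup (M : tm) x s : input_cells M x s ->
  run (setup_cmd M) (fun s' => holds (tm_init M x [::]) s' /\ s_out s' = s_out s) s.
Proof.
move=> hx; have [_ cC _ cB] := ctrlE M.
pose I (l : seq 'I_(tapes M)) s' := [/\ input_cells M x s',
  forall k : 'I_(tapes M), k \in l -> s_mem s' k = (cell M k 0).+1%:Z &
  s_out s' = s_out s].
apply: run_seq.
apply: run_post (run_cseqs (I := I) _ (enum_uniq _) _) => [s1 [h1 h2 h3]||].
- apply: run_seq; apply: run_set; apply: run_set; split=> //; split=> [k||].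
  + apply: holds_tape_upd => //; apply: holds_tape_upd => //; split=> //.
    by rewrite h2 // mem_enum.
  + by rewrite /= eqxx; case: eqP => //; rewrite /rCur /rBusy; lia.
  + by rewrite /= eqxx.
- move=> l k s1 _ [h1 h2 h3]; apply: run_set; split=> // [k' pos|k'].
    by rewrite /= h1; case: eqP => //; rewrite /cell; have := ltn_ord k; lia.
  rewrite mem_rcons inE /= (inj_eq val_inj).
  by case: eqVneq => [->|_ /h2].
- by [].
Qed.

(** [d] is the signed distance from the current column to the diagonal one. It starts at the row
    index and turns negative past the diagonal, whence the type [int]. *)
Fixpoint row_ops (d : int) (r : seq bool) : seq bool :=
  if r is b :: r' then
    (if d == 0 then [:: false; true] else [:: true; b]) ++ row_ops (d - 1) r'
  else [::].

Fixpoint rows_ops (n j : nat) (rows : seq (seq bool)) : seq bool :=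
  if rows is r :: rows' then
    nseq (2 * n) false ++ row_ops j r ++ rows_ops n j.+1 rows'
  else [::].

Lemma size_row_ops d r : size (row_ops d r) = (2 * size r)%N.
Proof. by elim: r d => //= b r IH d; case: ifP => _ /=; rewrite IH; lia. Qed.

Lemma size_rows_ops n j rows : all (fun r => size r == n) rows ->
  size (rows_ops n j rows) = (4 * n * size rows)%N.
Proof.
elim: rows j => [|r rows IH] j /=; first by rewrite muln0.
by move=> /andP[/eqP hr /IH hs]; rewrite !size_cat size_nseq size_row_ops hs hr; lia.
Qed.

Definition emit_cmd (M : tm) (b : bool) : cmd :=
  CSeq (CSet (rTmp M) (letter_code (Some (inl b) : tm_letter M)))
    (CSeq (CStore (rUser M 6) (rTmp M)) (CAdd (rUser M 6) (tapes M)%:Z)).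

(** Roles of the registers: 0 holds the number of vertices, 1 the rows left, 2 the inner loop
    counter, 3 the row index, 4 the distance to the diagonal, 5 the entry just read. *)
Definition user (M : tm) (s : store) : seq int :=
  [seq s_mem s (rUser M i) | i <- iota 0 6].

(* [v] lists the user registers 0 to 5; register 6 points to the end of the
   word [x] written so far on the input tape. *)
Definition emitted (M : tm) (x : seq bool) (v inp : seq int) (s : store) : Prop :=
  [/\ s_mem s (rUser M 6) = (cell M 0 (size x)).+1%:Z, input_cells M x s,
      user M s = v, s_in s = inp & s_out s = [::]].

Lemma emitted_get (M : tm) x v inp s i : (i < 6)%N -> emitted M x v inp s ->
  s_mem s (rUser M i) = nth 0 v i.
Proof. by move=> hi [_ _ <- _ _]; rewrite (nth_map 0%N) ?size_iota // nth_iota. Qed.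

Lemma rUser_eq (M : tm) i j : (rUser M i == rUser M j) = (i == j).
Proof. by rewrite eqn_add2l. Qed.

Lemma rUser_cell (M : tm) i (k : 'I_(tapes M)) pos : (i < 7)%N ->
  (cell M k pos == rUser M i) = false.
Proof. by rewrite /cell /rUser; lia. Qed.

Lemma emitted_upd (M : tm) x v inp s i z : (i < 6)%N -> emitted M x v inp s ->
  emitted M x (set_nth 0 v i z) inp (upd s (rUser M i) z).
Proof.
move=> hi [h1 h2 h3 h4 h5]; split=> //.
- by rewrite /= rUser_eq; case: eqP hi => // <-.
- by move=> k pos; rewrite /= rUser_cell ?h2 //; lia.
- rewrite -h3 /user; case: i hi => [|[|[|[|[|[|i]]]]]] //= _;
    by rewrite !rUser_eq.
Qed.

Lemma run_emit (M : tm) b x v inp s : emitted M x v inp s ->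
  run (emit_cmd M b) (emitted M (rcons x b) v inp) s.
Proof.
move=> [h1 h2 h3 h4 h5]; pose k0 : 'I_(tapes M) := ord0.
have eT i : (rUser M i == rTmp M) = false by rewrite /rUser /rTmp; lia.
apply: run_seq; apply: run_set; apply: run_seq.
apply: (@run_store _ _ (cell M k0 (size x))); first by rewrite /= eT h1.
apply: run_add; rewrite /= eqxx.
have e6 : (rUser M 6 == cell M k0 (size x)) = false.
  by rewrite eq_sym rUser_cell.
split=> //=.
- by rewrite eqxx e6 eT h1 size_rcons /cell; lia.
- move=> k pos; rewrite /= rUser_cell // (cell_inj k k0 pos (size x)).
  have -> : (cell M k pos == rTmp M) = false by rewrite /cell /rTmp; lia.
  rewrite h2 -cats1 -(inj_eq val_inj) /=.
  case: (k : nat) => [|[|i]] //=; rewrite onth_cat.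
  case: ltngtP => //= hp; last by rewrite hp subnn.
  by rewrite !onth_default //=; lia.
- rewrite -h3 /user /= !rUser_eq /=.
  have eC i : (i < 7)%N -> (rUser M i == cell M k0 (size x)) = false.
    by move=> hi; rewrite eq_sym rUser_cell.
  by rewrite !eC // !eT.
Qed.

Definition column_cmd (M : tm) : cmd :=
  CSeq (emit_cmd M false) (CSeq (emit_cmd M false) (CAdd (rUser M 2) (-1))).

Definition entry_cmd (M : tm) : cmd :=
  CSeq (CRead (rUser M 5))
    (CSeq (CIf (rUser M 4) 0 (CSeq (emit_cmd M false) (emit_cmd M true))
            (CSeq (emit_cmd M true)
              (CIf (rUser M 5) 0 (emit_cmd M false) (emit_cmd M true))))
      (CSeq (CAdd (rUser M 4) (-1)) (CAdd (rUser M 2) (-1)))).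

Definition row_cmd (M : tm) : cmd :=
  CSeq (CMov (rUser M 2) (rUser M 0))
    (CSeq (CWhile (rUser M 2) (column_cmd M))
      (CSeq (CSeq (CMov (rUser M 2) (rUser M 0)) (CMov (rUser M 4) (rUser M 3)))
        (CSeq (CWhile (rUser M 2) (entry_cmd M))
          (CSeq (CAdd (rUser M 3) 1) (CAdd (rUser M 1) (-1)))))).

Definition rows_cmd (M : tm) : cmd :=
  CSeq (CSeq (CSet (rUser M 6) (cell M 0 0).+1%:Z)
         (CSeq (CRead (rUser M 0)) (CMov (rUser M 1) (rUser M 0))))
    (CWhile (rUser M 1) (row_cmd M)).

Definition int_of_bits (r : seq bool) : seq int := [seq (nat_of_bool b)%:Z | b <- r].

Definition column_weight (M : tm) (n : nat) : nat :=
  n * (1 + rUser M 2 + weight (column_cmd M)) + (1 + rUser M 2).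

Lemma wp_columns (M : tm) n x (j i d b : int) inp s :
  emitted M x [:: n%:Z; j; n%:Z; i; d; b] inp s ->
  wp (CWhile (rUser M 2) (column_cmd M)) (column_weight M n)
    (emitted M (x ++ nseq (2 * n) false) [:: n%:Z; j; 0; i; d; b] inp) s.
Proof.
move=> h0.
(* As in the two other writing loops, the invariant says that the word emitted so far, followed by
   what remains to be emitted, is the target word. *)
pose I (k : nat) s := exists2 y, y ++ nseq (2 * k) false = x ++ nseq (2 * n) false &
  emitted M y [:: n%:Z; j; k%:Z; i; d; b] inp s.
apply: wp_post (leqnn _) _ (wp_while (I := I) _ (_ : I n s)).
- move=> s' [e [k' [y ey h]]].
  have := emitted_get (isT : 2 < 6)%N h; rewrite e => -[] /= k0.
  by move: ey h; rewrite -k0 muln0 cats0 => ->.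
- move=> k' s' [y ey h]; rewrite (emitted_get (isT : 2 < 6)%N h) /=.
  case: k' ey h => // k' ey h _; exists k'; split=> //; apply: wp_run => //.
  apply/run_seq/(run_post _ (run_emit _ h)) => s1 h1.
  apply/run_seq/(run_post _ (run_emit _ h1)) => s2 h2.
  apply: run_add; exists (rcons (rcons y false) false).
    by rewrite -ey -!cats1 -!catA mulnS.
  rewrite (emitted_get (isT : 2 < 6)%N h2).
  have /= := emitted_upd (k'.+1%:Z - 1) (isT : 2 < 6)%N h2.
  by rewrite (_ : k'.+1%:Z - 1 = k'); last lia.
- by exists x.
Qed.

Definition entry_weight (M : tm) (n : nat) : nat :=
  n * (1 + rUser M 2 + weight (entry_cmd M)) + (1 + rUser M 2).

Lemma wp_entries (M : tm) n x (j i d b : int) r inp s : size r = n ->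
  emitted M x [:: n%:Z; j; n%:Z; i; d; b] (int_of_bits r ++ inp) s ->
  wp (CWhile (rUser M 2) (entry_cmd M)) (entry_weight M n)
    (fun s' => exists d' b' : int,
      emitted M (x ++ row_ops d r) [:: n%:Z; j; 0; i; d'; b'] inp s') s.
Proof.
move=> hr h0.
pose I (k : nat) s := exists y r' (d' b' : int),
  [/\ y ++ row_ops d' r' = x ++ row_ops d r, size r' = k &
  emitted M y [:: n%:Z; j; k%:Z; i; d'; b'] (int_of_bits r' ++ inp) s].
apply: wp_post (leqnn _) _ (wp_while (I := I) _ (_ : I n s)).
- move=> s' [e [k' [y [r' [d' [b' [ey er h]]]]]]]; exists d', b'.
  have := emitted_get (isT : 2 < 6)%N h; rewrite e => -[] /= k0.
  by move: er ey h; rewrite -k0 => /size0nil -> /=; rewrite cats0 => ->.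
- move=> k' s' [y [r' [d' [b' [ey er h]]]]].
  rewrite (emitted_get (isT : 2 < 6)%N h) /=.
  case: k' r' er ey h => [|k'] [|c r'] //= [er] ey h _.
  exists k'; split=> //; apply: wp_run => //.
  apply/run_seq/run_read.
  set s1 := upd _ _ _.
  have h1 : emitted M y [:: n%:Z; j; k'.+1%:Z; i; d'; (c : nat)%:Z]
      (int_of_bits r' ++ inp) s1.
    have [g1 g2 g3 g4 g5] := h.
    have := @emitted_upd M y [:: n%:Z; j; k'.+1%:Z; i; d'; b'] (int_of_bits r' ++ inp)
      (Store (s_mem s') (behead (s_in s')) (s_out s')) 5 (head 0 (s_in s')) isT.
    by rewrite /s1 g4 /=; apply; split.
  apply: run_seq.
  pose op := if d' == 0 then [:: false; true] else [:: true; c].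
  apply: (@run_post _ (emitted M (y ++ op)
    [:: n%:Z; j; k'.+1%:Z; i; d'; (c : nat)%:Z] (int_of_bits r' ++ inp))).
    move=> s2 h2; apply/run_seq/run_add.
    rewrite (emitted_get (isT : 4 < 6)%N h2).
    have /= h3 := emitted_upd (d' - 1) (isT : 4 < 6)%N h2.
    apply: run_add; rewrite (emitted_get (isT : 2 < 6)%N h3) /=.
    exists (y ++ op), r', (d' - 1), (c : nat)%:Z; split=> //.
      by rewrite -catA.
    have /= := emitted_upd (k'.+1%:Z - 1) (isT : 2 < 6)%N h3.
    by rewrite (_ : k'.+1%:Z - 1 = k'); last lia.
  apply: run_if; rewrite (emitted_get (isT : 4 < 6)%N h1) /= /op.
  have cat2 u v : y ++ [:: u; v] = rcons (rcons y u) v.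
    by rewrite -!cats1 -catA.
  case: ifP => _; apply/run_seq/(run_post _ (run_emit _ h1)) => s2 h2.
    by rewrite cat2; apply: run_emit.
  apply: run_if; rewrite (emitted_get (isT : 5 < 6)%N h2) /= cat2.
  by case: c {ey h h1 op} h2 => h2; apply: run_emit.
- by exists x, r, d, b.
Qed.

Definition row_weight (M : tm) (n : nat) : nat :=
  (1 + rUser M 2 + rUser M 0) + (column_weight M n +
   ((1 + rUser M 2 + rUser M 0 + (1 + rUser M 4 + rUser M 3)) +
    (entry_weight M n + (1 + rUser M 3 + 1 + (1 + rUser M 1 + 1))))).

Lemma wp_row (M : tm) n (i : nat) x (j k d b : int) r inp s : size r = n ->
  emitted M x [:: n%:Z; j; k; i%:Z; d; b] (int_of_bits r ++ inp) s ->
  wp (row_cmd M) (row_weight M n)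
    (fun s' => exists d' b' : int,
      emitted M (x ++ nseq (2 * n) false ++ row_ops i r)
        [:: n%:Z; j - 1; 0; i.+1%:Z; d'; b'] inp s') s.
Proof.
move=> hr h0; apply: wp_seq; apply: wp_run => //; apply: run_mov.
rewrite (emitted_get (isT : 0 < 6)%N h0).
have /= h1 := emitted_upd n%:Z (isT : 2 < 6)%N h0.
apply: wp_seq; apply: wp_post (leqnn _) _ (wp_columns h1) => s2 h2.
apply: wp_seq; apply: wp_run => //; apply/run_seq/run_mov.
rewrite (emitted_get (isT : 0 < 6)%N h2).
have /= h3 := emitted_upd n%:Z (isT : 2 < 6)%N h2.
apply: run_mov; rewrite (emitted_get (isT : 3 < 6)%N h3).
have /= h4 := emitted_upd i%:Z (isT : 4 < 6)%N h3.
apply: wp_seq; apply: wp_post (leqnn _) _ (wp_entries hr h4) => s5 [d' [b' h5]].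
apply: wp_run => //; apply/run_seq/run_add.
rewrite (emitted_get (isT : 3 < 6)%N h5).
have /= h6 := emitted_upd (i%:Z + 1) (isT : 3 < 6)%N h5.
apply: run_add; rewrite (emitted_get (isT : 1 < 6)%N h6).
have /= h7 := emitted_upd (j + -1) (isT : 1 < 6)%N h6.
exists d', b'; rewrite catA.
by rewrite (_ : i.+1%:Z = i%:Z + 1); last lia.
Qed.

Lemma wp_rows (M : tm) : exists C : nat, forall n (rows : seq (seq bool)),
  size rows = n -> all (fun r => size r == n) rows ->
  wp (rows_cmd M) (C * n.+1 ^ 2)
    (fun s => input_cells M (rows_ops n 0 rows) s /\ s_out s = [::])
    (Store (fun=> 0) (n%:Z :: int_of_bits (flatten rows)) [::]).
Proof.
pose W0 := weight (CSeq (CSet (rUser M 6) (cell M 0 0).+1%:Z)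
         (CSeq (CRead (rUser M 0)) (CMov (rUser M 1) (rUser M 0)))).
(* [row_weight M n] is affine in [n]. The constant collects its value at 0, its two slopes and the
   fixed costs, so that all [n] rows fit in [C * n.+1 ^ 2]. *)
exists (W0 + (1 + rUser M 1) + (1 + rUser M 1 + row_weight M 0 +
  (1 + rUser M 2 + weight (column_cmd M)) + (1 + rUser M 2 + weight (entry_cmd M))))%N.
move=> n rows hn hrows.
set s := Store _ _ _.
have h0 : emitted M [::] (nseq 6 0) (n%:Z :: int_of_bits (flatten rows))
    (upd s (rUser M 6) (cell M 0 0).+1%:Z).
  split=> //; rewrite /= ?eqxx //.
  - move=> k pos; rewrite /= rUser_cell //.
    by case: (k : nat) => [|[|i]]; rewrite ?onth0n //= nth_nil onth0n.
  - by rewrite /user /= !rUser_eq.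
pose I (k : nat) s := exists y rs (i : nat) (K d b : int),
  [/\ y ++ rows_ops n i rs = rows_ops n 0 rows, size rs = k,
      all (fun r => size r == n) rs &
  emitted M y [:: n%:Z; k%:Z; K; i%:Z; d; b] (int_of_bits (flatten rs)) s].
suff H : wp (rows_cmd M)
    (W0 + (n * (1 + rUser M 1 + row_weight M n) + (1 + rUser M 1)))
    (fun s => input_cells M (rows_ops n 0 rows) s /\ s_out s = [::]) s.
  apply: wp_post _ (fun _ => id) H.
  rewrite /row_weight /column_weight /entry_weight.
  move: (W0) (weight _) (weight _) => w0 w1 w2; nia.
apply: wp_seq; apply: wp_run => //; apply/run_seq/run_set.
apply/run_seq/run_read.
set s1 := upd (Store _ _ _) _ _.
have h1 : emitted M [::] [:: n%:Z; 0; 0; 0; 0; 0] (int_of_bits (flatten rows)) s1.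
  have [g1 g2 g3 g4 g5] := h0.
  exact: (@emitted_upd M [::] (nseq 6 0) (int_of_bits (flatten rows))
    (Store (s_mem (upd s (rUser M 6) (cell M 0 0).+1%:Z)) (int_of_bits (flatten rows))
      [::]) 0 n%:Z isT).
apply: run_mov; rewrite (emitted_get (isT : 0 < 6)%N h1).
have /= h2 := emitted_upd n%:Z (isT : 1 < 6)%N h1.
apply: wp_post (leqnn _) _ (wp_while (I := I) _ (_ : I n _)).
- move=> s' [e [k' [y [r' [i [K [d [b [ey er _ h]]]]]]]]].
  have := emitted_get (isT : 1 < 6)%N h; rewrite e => -[] /= k0.
  move: er ey h; rewrite -k0 => /size0nil -> /=; rewrite cats0 => ->.
  by case.
- move=> k' s' [y [rs [i [K [d [b [ey er al h]]]]]]].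
  rewrite (emitted_get (isT : 1 < 6)%N h) /=.
  case: k' rs er ey al h => [|k'] [|r rs] //= [er] ey /andP[/eqP hr al] h _.
  exists k'; split=> //.
  rewrite /int_of_bits map_cat in h.
  apply: wp_post (leqnn _) _ (wp_row hr h) => s3 [d' [b' h3]].
  exists (y ++ nseq (2 * n) false ++ row_ops i r), rs, i.+1, 0, d', b'.
  split=> //; first by rewrite -ey !catA.
  by move: h3; rewrite (_ : k'.+1%:Z - 1 = k'); last lia.
- by exists [::], rows, 0%N, 0, 0, 0.
Qed.

(** * The complete RAM program: write the code, simulate, answer *)

Lemma tm_run_halted (M : tm) x w t i : tm_halts_in M x w t ->
  tm_run M x w (i + t) = tm_run M x w t.
Proof.
move=> h; elim: i => // i IH.
by rewrite addSn /tm_run iterS -/(tm_run M x w (i + t)) IH /tm_step h.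
Qed.

(** Halting configurations are fixed by [tm_step], so every halting time gives the same verdict. *)
Lemma tm_acceptsE (M : tm) x w t : tm_halts_in M x w t ->
  tm_accepts M x w <-> tm_accept (tmc_state (tm_run M x w t)).
Proof.
move=> h; split=> [[u [hu au]]|a]; last by exists t.
by rewrite -(tm_run_halted u h) addnC tm_run_halted.
Qed.

Lemma ram_simulates (M : tm) : exists (p : seq ram_instr) (C : nat),
  forall n (rows : seq (seq bool)) T,
  size rows = n -> all (fun r => size r == n) rows ->
  tm_halts_in M (rows_ops n 0 rows) [::] T ->
  exists (t : nat) (b : bool),
    [/\ ram_run p (ram_init (n%:Z :: int_of_bits (flatten rows))) t
          [:: (b : nat)%:Z],
        (t <= C * (n.+1 ^ 2 + T) * log_size (C * (n.+1 ^ 2 + T))%N)%N &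
        b <-> tm_accepts M (rows_ops n 0 rows) [::]].
Proof.
have [C hC] := wp_rows M.
pose c := CSeq (rows_cmd M) (CSeq (setup_cmd M)
  (CSeq (CWhile (rBusy M) (step_cmd M)) (answer_cmd M))).
pose C1 := (C + weight (setup_cmd M) + (1 + rBusy M + weight (step_cmd M)) +
  (1 + rBusy M) + weight (answer_cmd M))%N.
(* The factor 12 is that of [exec_compile]; the summand 2 absorbs the final halt and the bound
   [n.+1] on the input integers. *)
exists (compile c 0), (12 * C1 + 2)%N => n rows T hn hrows hT.
set x := rows_ops n 0 rows in hT *.
set inp := _ :: _.
have [w [s [es lw [t [q hq]]]]] : wp c (C1 * (n.+1 ^ 2 + T))%N
   (fun s => exists t, tm_halts_in M x [::] t /\
      s_out s = [:: (tm_accept (tmc_state (tm_run M x [::] t)) : nat)%:Z])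
   (Store (fun=> 0) inp [::]).
  suff H : wp c (C * n.+1 ^ 2 + (weight (setup_cmd M) +
     ((T * (1 + rBusy M + weight (step_cmd M)) + (1 + rBusy M)) +
      weight (answer_cmd M))))%N
   (fun s => exists t, tm_halts_in M x [::] t /\
      s_out s = [:: (tm_accept (tmc_state (tm_run M x [::] t)) : nat)%:Z])
   (Store (fun=> 0) inp [::]).
    apply: wp_post _ (fun _ => id) H; rewrite /C1.
    move: (weight _) (weight _) (weight _) => w0 w1 w2; nia.
  apply: wp_seq; apply: wp_post (leqnn _) _ (hC _ _ hn hrows) => s1 [h1 o1].
  apply: wp_seq; apply: wp_run; first exact: loop_free_setup.
  apply: run_post (run_setup h1) => s2 [h2 o2].
  apply: wp_seq.
  apply: wp_post (leqnn _) _ (wp_simulate hT h2) => s3 [t [ht [_ hq _] o3]].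
  apply: wp_run; first exact: loop_free_answer.
  apply: run_post (run_answer hq _) => [s4 o4|]; first by exists t.
  by rewrite o3 o2 o1.
have hB : all (fun z : int => `|z| <= n.+1)%N inp.
  rewrite /= leqnSn all_map; apply/allP => b _ /=.
  by case: b.
have [u hu] := compile_run es hB; rewrite hq => hr.
exists u, (tm_accept (tmc_state (tm_run M x [::] t))); split=> //.
- have e : (n.+1 + w <= (12 * C1 + 2) * (n.+1 ^ 2 + T))%N.
    by move: lw; rewrite mulnDl; nia.
  apply: leq_trans hu _; have := @leq_log_size (n.+1 + w)%N _ e.
  set L := log_size (n.+1 + w)%N; set L' := log_size _ => hL.
  have : (12 * w * L <= 12 * (C1 * (n.+1 ^ 2 + T)) * L')%N.
    by apply: leq_mul => //; rewrite leq_mul2l.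
  have L0 : (0 < L')%N by [].
  have : (0 < (n.+1 ^ 2 + T) * L')%N by rewrite muln_gt0 L0 addn_gt0 expn_gt0.
  rewrite mulnDl mulnDl -!mulnA; lia.
- by rewrite (tm_acceptsE q).
Qed.

(** * A Turing machine for triangles *)

(* The components are, in order: the entries of the current row are being read
   (rather than the decrement steps); borrow of the decrement; [None] before the
   row v chosen by the oracle, [Some false] in it and [Some true] afterwards; v is
   adjacent to the current row; they have a common neighbour; a triangle was
   found. *)
Definition core : finType := (bool * bool * option bool * bool * bool * bool)%type.
Definition letter : Type := option (bool + void).
Definition is_one (l : letter) : bool := l == Some (inl true).

(** On a pair 00, [ph] being still true marks the first step of a row, which injects the borrow 1; a
    blank under the oracle head passes the borrow on. On other pairs, [ph] false marks the first
    entry of a row: the final borrow then settles the mode, and [ad] and [co] restart from false.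
    The diagonal pair 01 has [bit] false, so row v is copied with a 0 on the diagonal and the
    current vertex never counts as a common neighbour. *)
Definition op_fun (b1 b2 : bool) (c : core) (l1 l2 : letter) :
    core * (letter * move) * (letter * move) :=
  let: (ph, bo, mo, ad, co, fo) := c in
  if ~~ b1 && ~~ b2 then
    let bo1 := ph || bo in
    if l1 is Some (inl b) then
      ((false, bo1 && ~~ b, mo, ad, co, fo), (Some (inl (b (+) bo1)), MoveR),
       (l2, MoveL))
    else ((false, bo1, mo, ad, co, fo), (l1, Stay), (l2, MoveL))
  else
    let mo1 := if ph then mo else
      if mo is Some _ then Some true else if bo then Some false else None in
    let bit := b1 && b2 in
    let ad1 := ph && ad || ~~ b1 && is_one l2 in
    let co1 := ph && co || bit && is_one l2 in
    ((true, bo, mo1, ad1, co1, fo || [&& mo1 == Some true, ad1 & co1]),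
     (l1, MoveL), (if mo1 == Some false then Some (inl bit) else l2, MoveR)).

(** Halting flag, first bit of a pair whose second bit is still to come, and core. *)
Definition tri_state : finType := (bool * option bool * core)%type.

Definition tri_trans (q : tri_state) (a : {ffun 'I_3 -> letter}) :
    tri_state * {ffun 'I_3 -> letter * move} :=
  let: (_, pend, c) := q in
  let go q' act1 act2 := (q', [ffun k : 'I_3 =>
    nth act2 [:: (a k, MoveR); act1; act2] k]) in
  if a ord0 is Some (inl b) then
    if pend is Some b1 then
      let: (c', act1, act2) := op_fun b1 b c (a (inord 1)) (a (inord 2)) in
      go (false, None, c') act1 act2
    else go (false, Some b, c) (a (inord 1), Stay) (a (inord 2), Stay)
  else go (true, pend, c) (a (inord 1), Stay) (a (inord 2), Stay).

(** The phase starts as true so that the first row, like the others, begins by injecting a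
    borrow. *)
Definition core0 : core := (true, false, None, false, false, false).

Definition tri_tm : tm :=
  @Tm 1 tri_state void (false, None, core0) (fun q => q.1.1) (fun q => q.2.2) tri_trans.

(** The input tape is dropped: being scanned once from left to right, it turns a computation into a
    fold of [read] over the input letters. *)
Record astate := AState {
  a_core : core; a_orc : nat -> letter; a_oh : nat;
  a_row : nat -> letter; a_rh : nat }.

Definition op (b1 b2 : bool) (s : astate) : astate :=
  let: (c, act1, act2) := op_fun b1 b2 (a_core s)
    (a_orc s (a_oh s)) (a_row s (a_rh s)) in
  AState c [eta a_orc s with a_oh s |-> act1.1] (move_head act1.2 (a_oh s))
    [eta a_row s with a_rh s |-> act2.1] (move_head act2.2 (a_rh s)).

Definition read (s : option bool * astate) (b : bool) : option bool * astate :=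
  if s.1 is Some b1 then (None, op b1 b s.2) else (Some b, s.2).

Definition tape_of (x : seq bool) (pos : nat) : letter := omap inl (onth x pos).

Definition astart (w : seq bool) : option bool * astate :=
  (None, AState core0 (tape_of w) 0 (tape_of [::]) 0).

Definition tri_config (x : seq bool) (fin : bool) (h : nat)
    (s : option bool * astate) : tm_config tri_tm :=
  @TmConfig tri_tm (fin, s.1, a_core s.2)
    (fun k => nth 0%N [:: h; a_oh s.2; a_rh s.2] k)
    (fun k => nth (tape_of [::]) [:: tape_of x; a_orc s.2; a_row s.2] k).

Lemma ord3P (P : 'I_3 -> Prop) : P ord0 -> P (inord 1) -> P (inord 2) ->
  forall k, P k.
Proof.
move=> h0 h1 h2 k; have e (i : 'I_3) : i = inord i by rewrite inord_val.
case: k => -[|[|[|//]]] hk.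
- by rewrite (_ : Ordinal hk = ord0) //; apply: val_inj.
- by rewrite (e (Ordinal hk)).
- by rewrite (e (Ordinal hk)).
Qed.

Lemma eta_same (T : Type) (f : nat -> T) i z : f i = z ->
  [eta f with i |-> z] = f :> (nat -> T).
Proof. by move=> <-; apply/funext => j /=; case: eqP => // ->. Qed.

Lemma eta_id (T : Type) (f : nat -> T) i : [eta f with i |-> f i] = f :> (nat -> T).
Proof. exact: eta_same. Qed.

Lemma tri_step x t s b : onth x t = Some b ->
  tm_step (tri_config x false t s) = tri_config x false t.+1 (read s b).
Proof.
move=> hb; rewrite /tm_step /=.
set a := finfun _.
have a0 : a ord0 = Some (inl b) by rewrite ffunE /= /tape_of hb.
have a1 : a (inord 1) = a_orc s.2 (a_oh s.2) by rewrite ffunE /= inordK.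
have a2 : a (inord 2) = a_row s.2 (a_rh s.2) by rewrite ffunE /= inordK.
rewrite /tri_trans a0 a1 a2 /read.
case: s a a0 a1 a2 => [[b1|] s] a a0 a1 a2 /=.
  rewrite /op; case: op_fun => -[c' act1] act2 /=.
  congr TmConfig; apply/funext; apply: ord3P; rewrite !ffunE /= ?inordK //.
  by rewrite a0 /= -[RHS](eta_id _ t) /tape_of hb.
congr TmConfig; apply/funext; apply: ord3P; rewrite !ffunE /= ?inordK //.
- by rewrite a0 /= -[RHS](eta_id _ t) /tape_of hb.
- exact: eta_id.
- exact: eta_id.
Qed.

Lemma tri_run x w t : (t <= size x)%N ->
  tm_run tri_tm x w t = tri_config x false t (foldl read (astart w) (take t x)).
Proof.
elim: t => [_|t IH ht].
  rewrite take0 /=; congr TmConfig; apply/funext; apply: ord3P => //=;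
    by rewrite ?inordK //; apply/funext.
rewrite /tm_run iterS -/(tm_run tri_tm x w t) IH; last exact: ltnW.
rewrite (take_nth false ht) foldl_rcons; apply: tri_step.
have : onth x t by rewrite onthTE.
by rewrite -odflt_onth; case: (onth x t).
Qed.

Definition found (s : astate) : bool := (a_core s).2.

Lemma tri_end x w :
  tm_run tri_tm x w (size x).+1 =
    tri_config x true (size x).+1 (foldl read (astart w) x).
Proof.
rewrite /tm_run iterS -/(tm_run tri_tm x w (size x)) tri_run // take_size.
set s := foldl _ _ _.
rewrite /tm_step /=; set a := finfun _.
have a0 : a ord0 = None by rewrite ffunE /= /tape_of onth_default.
have a1 : a (inord 1) = a_orc s.2 (a_oh s.2) by rewrite ffunE /= inordK.
have a2 : a (inord 2) = a_row s.2 (a_rh s.2) by rewrite ffunE /= inordK.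
rewrite /tri_trans a0 a1 a2 /=.
congr TmConfig; apply/funext; apply: ord3P; rewrite !ffunE /= ?inordK //.
all: exact: eta_id.
Qed.

Lemma tri_halts x w : tm_halts_in tri_tm x w (size x).+1.
Proof. by rewrite /tm_halts_in tri_end. Qed.

Lemma tri_accepts x w :
  tm_accepts tri_tm x w <-> found (foldl read (astart w) x).2.
Proof. by rewrite (tm_acceptsE (tri_halts x w)) tri_end. Qed.

(** * The effect of one row of the code *)

Fixpoint sweep (d : int) (r : seq bool) (s : astate) : astate :=
  if r is b :: r' then
    sweep (d - 1) r' (if d == 0 then op false true s else op true b s)
  else s.

Lemma read_columns n s :
  foldl read (None, s) (nseq (2 * n) false) = (None, iter n (op false false) s).
Proof. by elim: n s => // n IH s; rewrite mulnS iterSr -IH. Qed.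

Lemma read_row_ops d r s : foldl read (None, s) (row_ops d r) = (None, sweep d r s).
Proof.
elim: r d s => //= b r IH d s; rewrite foldl_cat.
by case: ifP => _; rewrite -IH.
Qed.

(* [n] steps of decrementing a binary number, least significant bit first, with
   incoming borrow [c]; returns the outgoing borrow. *)
Fixpoint dec (n : nat) (c : bool) (w : seq bool) : seq bool * bool :=
  match n, w with
  | n'.+1, b :: w' => let: (v, c') := dec n' (c && ~~ b) w' in (b (+) c :: v, c')
  | _, _ => (w, c)
  end.

Fixpoint bits_val (w : seq bool) : nat :=
  if w is b :: w' then b + 2 * bits_val w' else 0.

(** A value below [2 ^ n] has only zero bits from position [n] on, so [n] steps complete the
    subtraction whatever the length of [w]. *)
Lemma dec_val n c w : (bits_val w < 2 ^ n)%N ->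
  (dec n c w).2 = c && (bits_val w == 0)%N /\
  (c ==> (0 < bits_val w)%N -> bits_val (dec n c w).1 = (bits_val w - c)%N).
Proof.
elim: n c w => [|n IH] c [|b w] //=; rewrite ?andbT.
- by case: c; split=> // _; rewrite subn0.
- rewrite expn0 ltnS leqn0 => /eqP e; rewrite e eqxx andbT; split=> //.
  by case: c => //= _; rewrite e.
- rewrite expnS => hw; have /(IH (c && ~~ b)) : (bits_val w < 2 ^ n)%N by lia.
  case: (dec n (c && ~~ b) w) => v c' /= [-> hv]; split.
    by case: c b hw hv => [] [] //= *; lia.
  by case: c b hw hv => [] [] //= *; rewrite ?hv; lia.
Qed.

Lemma exists_bits l v : (v < 2 ^ l)%N ->
  exists2 w : seq bool, size w = l & bits_val w = v.
Proof.
elim: l v => [|l IH] v; first by rewrite expn0 ltnS leqn0 => /eqP->; exists [::].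
rewrite expnS => hv; have [|w hw e] := IH v./2; first by lia.
by exists (odd v :: w); rewrite /= ?hw // e; lia.
Qed.

Lemma tape_of_set pre b b' w :
  [eta tape_of (pre ++ b :: w) with size pre |-> Some (inl b')] =
  tape_of (pre ++ b' :: w) :> (nat -> letter).
Proof.
apply/funext => i /=; rewrite /tape_of !onth_cat; case: eqP => [->|ne].
  by rewrite ltnn subnn.
by case: ltnP => // hi; rewrite -(@subnSK (size pre) i) //; lia.
Qed.

(** [pre] holds the bits already treated. Once the oracle word is exhausted, the head waits on the
    blank with the borrow unchanged, whence the [minn]. *)
Lemma iter_columns n c mo ad co fo pre w row rh :
  iter n (op false false)
    (AState (false, c, mo, ad, co, fo) (tape_of (pre ++ w)) (size pre) row rh) =
  AState (false, (dec n c w).2, mo, ad, co, fo) (tape_of (pre ++ (dec n c w).1))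
    (size pre + minn n (size w)) row (rh - n).
Proof.
elim: n c pre w rh => [|n IH] c pre w rh; first by rewrite min0n addn0 subn0.
rewrite iterSr; case: w => [|b w].
  rewrite cats0 /op /= (_ : tape_of pre (size pre) = None) /=; last first.
    by rewrite /tape_of onth_default.
  rewrite eta_id eta_same; last by rewrite /tape_of onth_default.
  have := IH c pre [::] rh.-1; rewrite cats0 => ->.
  have d0 m : dec m c [::] = ([::], c) by case: m.
  by rewrite !d0 /= ?cats0 !minn0; congr AState; lia.
rewrite /op /= (_ : tape_of (pre ++ b :: w) (size pre) = Some (inl b)) /=; last first.
  by rewrite /tape_of onth_cat ltnn subnn.
rewrite eta_id tape_of_set.
have := IH (c && ~~ b) (rcons pre (b (+) c)) w rh.-1.
rewrite cat_rcons size_rcons => ->.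
case: (dec n _ w) => v c' /=; rewrite cat_rcons; congr AState; lia.
Qed.

(** Leaving the entry phase acts as an incoming borrow 1, and [rh <= n] ensures that [n] left moves
    bring the row head to cell 0. *)
Lemma columns_start n bo mo ad co fo w row rh : (0 < n)%N -> (rh <= n)%N ->
  iter n (op false false) (AState (true, bo, mo, ad, co, fo) (tape_of w) 0 row rh) =
  AState (false, (dec n true w).2, mo, ad, co, fo) (tape_of (dec n true w).1)
    (minn n (size w)) row 0.
Proof.
case: n => // n _ hrh.
have := iter_columns n.+1 true mo ad co fo [::] w row rh.
rewrite !iterSr (_ : rh - n.+1 = 0)%N; last by lia.
by move=> <-; congr iter; rewrite /op /=; case: (tape_of w 0) => [[]|].
Qed.

Definition next_mode (mo : option bool) (c : bool) : option bool :=
  if mo is Some _ then Some true else if c then Some false else None.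

Lemma sweep_start d r c mo ad co fo w oh row rh : (0 < size r)%N ->
  sweep d r (AState (false, c, mo, ad, co, fo) w oh row rh) =
  sweep d r (AState (true, c, next_mode mo c, false, false, fo) w oh row rh).
Proof. by case: r => //= b r _; case: ifP. Qed.

Lemma sweep_search d r c ad co fo w oh row rh : exists ad' co',
  sweep d r (AState (true, c, None, ad, co, fo) w oh row rh) =
  AState (true, c, None, ad', co', fo) w (oh - size r) row (rh + size r).
Proof.
elim: r d ad co oh rh => [|b r IH] d ad co oh rh /=.
  by exists ad, co; rewrite subn0 addn0.
pose ad1 := ad || (d == 0) && is_one (row rh).
pose co1 := co || [&& d != 0, b & is_one (row rh)].
have [ad' [co' e]] := IH (d - 1) ad1 co1 oh.-1 rh.+1; exists ad', co'.
have -> : (oh - (size r).+1 = oh.-1 - size r)%N by lia.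
rewrite addnS -addSn -e; congr sweep.
by rewrite /op /= /ad1 /co1; case: eqP => _ /=; rewrite !eta_id ?orbF.
Qed.

Lemma sweep_record d r c ad co fo w oh row rh : exists ad' co' row',
  sweep d r (AState (true, c, Some false, ad, co, fo) w oh row rh) =
  AState (true, c, Some false, ad', co', fo) w (oh - size r) row' (rh + size r) /\
  forall k, is_one (row' k) = if (rh <= k < rh + size r)%N
    then (d != (k - rh)%N%:Z) && nth false r (k - rh) else is_one (row k).
Proof.
elim: r d ad co oh row rh => [|b r IH] d ad co oh row rh /=.
  exists ad, co, row; rewrite subn0 addn0; split=> // k.
  by rewrite leqNgt andNb.
pose bit := (d != 0) && b.
have [ad' [co' [row' [e hr]]]] := IH (d - 1)
  (ad || (d == 0) && is_one (row rh)) (co || bit && is_one (row rh)) oh.-1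
  [eta row with rh |-> Some (inl bit)] rh.+1.
exists ad', co', row'; split.
  have -> : (oh - (size r).+1 = oh.-1 - size r)%N by lia.
  rewrite addnS -addSn -e; congr sweep.
  by rewrite /op /= /bit; case: eqP => _ /=; rewrite eta_id ?orbF.
move=> k; rewrite hr /=; case: (ltngtP k rh) => hk.
- by [].
- have -> : (k - rh)%N = (k - rh.+1).+1 by lia.
  by rewrite /= addnS -addSn; case: ifP => // _; congr (_ && _); lia.
- rewrite hk subnn (_ : (rh < rh + (size r).+1)%N) /= /bit; last by lia.
  by rewrite /is_one; case: (d == 0); case: (b).
Qed.

Fixpoint adj_in (d : int) (k : nat) (row : nat -> letter) (r : seq bool) : bool :=
  if r is b :: r' then
    (d == 0) && is_one (row k) || adj_in (d - 1) k.+1 row r'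
  else false.

Fixpoint common_in (d : int) (k : nat) (row : nat -> letter) (r : seq bool) : bool :=
  if r is b :: r' then
    [&& d != 0, b & is_one (row k)] || common_in (d - 1) k.+1 row r'
  else false.

Lemma sweep_check d r c ad co fo w oh row rh : (ad && co ==> fo) ->
  exists ad' co',
  sweep d r (AState (true, c, Some true, ad, co, fo) w oh row rh) =
  AState (true, c, Some true, ad', co',
    fo || (ad || adj_in d rh row r) && (co || common_in d rh row r))
    w (oh - size r) row (rh + size r).
Proof.
elim: r d ad co fo oh rh => [|b r IH] d ad co fo oh rh h /=.
  exists ad, co; rewrite subn0 addn0 !orbF.
  by case: (ad && co) fo h => [] [].
pose ad1 := ad || (d == 0) && is_one (row rh).
pose co1 := co || [&& d != 0, b & is_one (row rh)].
have [|ad' [co' e]] := IH (d - 1) ad1 co1 (fo || ad1 && co1) oh.-1 rh.+1.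
  by apply/implyP => ->; rewrite orbT.
exists ad', co'.
have -> : (oh - (size r).+1 = oh.-1 - size r)%N by lia.
rewrite addnS -addSn !orbA -/ad1 -/co1.
have <- : fo || ad1 && co1 || (ad1 || adj_in (d - 1) rh.+1 row r) &&
    (co1 || common_in (d - 1) rh.+1 row r) =
  fo || (ad1 || adj_in (d - 1) rh.+1 row r) &&
    (co1 || common_in (d - 1) rh.+1 row r).
  by case: fo ad1 co1 {h e} => [] [] [].
rewrite -e; congr sweep.
by rewrite /op /= /ad1 /co1; case: eqP => _ /=; rewrite !eta_id ?orbF.
Qed.

Lemma adj_inE j k row r :
  adj_in (j%:Z - k%:Z) k row r = [&& (k <= j)%N, (j < k + size r)%N & is_one (row j)].
Proof.
elim: r k => [|b r IH] k /=; first by rewrite addn0; case: ltngtP.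
have -> : j%:Z - k%:Z - 1 = j%:Z - k.+1%:Z by lia.
rewrite IH addnS -addSn subr_eq0 eqz_nat.
case: (ltngtP k j) => //= ->.
by rewrite orbF (_ : (j < j.+1 + size r)%N) //; lia.
Qed.

Lemma common_inP j k row r :
  reflect (exists i, [&& (k <= i)%N, (i < k + size r)%N, i != j,
                         nth false r (i - k) & is_one (row i)])
    (common_in (j%:Z - k%:Z) k row r).
Proof.
elim: r k => [|b r IH] k /=.
  by apply: ReflectF => -[i]; rewrite addn0 => /and3P[]; lia.
have -> : j%:Z - k%:Z - 1 = j%:Z - k.+1%:Z by lia.
rewrite subr_eq0 eqz_nat; apply: (iffP orP) => [[/and3P[h1 h2 h3]|/IH[i]]|[i]].
- by exists k; rewrite leqnn subnn /= eq_sym h1 h2 h3 !andbT; lia.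
- move=> /and5P[h1 h2 h3 h4 h5]; exists i; rewrite h3 h5 andbT.
  have -> : (i - k)%N = (i - k.+1).+1 by lia.
  by rewrite /= h4; lia.
- move=> /and5P[h1 h2 h3 h4 h5]; have [ki|ki] := eqVneq k i.
    by left; move: h4; rewrite ki subnn /= eq_sym h3 h5 andbT.
  right; apply/IH; exists i; rewrite h3 h5 andbT.
  move: h4; have -> : (i - k)%N = (i - k.+1).+1 by lia.
  by move=> /= ->; lia.
Qed.

(** The borrow and the flags [ad] and [co] may be anything at a row boundary, because the next row
    resets them. *)
Definition row_start (n : nat) (mo : option bool) (fo : bool) (w : seq bool)
    (row : nat -> letter) (s : astate) : Prop :=
  exists bo ad co rh, (rh <= n)%N /\
    s = AState (true, bo, mo, ad, co, fo) (tape_of w) 0 row rh.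

Definition do_row (n j : nat) (r : seq bool) (s : astate) : astate :=
  sweep j r (iter n (op false false) s).

Lemma do_row_start n j r mo fo w row s : (0 < n)%N -> size r = n ->
  row_start n mo fo w row s ->
  let mo' := next_mode mo (dec n true w).2 in
  exists fo' row', row_start n mo' fo' (dec n true w).1 row' (do_row n j r s) /\
    match mo' with
    | None => fo' = fo
    | Some false => fo' = fo /\
        forall k, (k < n)%N -> is_one (row' k) = (k != j) && nth false r k
    | Some true => row' = row /\
        fo' = fo || [&& (j < n)%N, is_one (row j) & common_in j 0 row r]
    end.
Proof.
move=> n0 hr [bo [ad [co [rh [hrh ->]]]]] mo'.
rewrite /do_row columns_start // sweep_start ?hr // -/mo'.
(* The decrement steps leave the oracle head at most [n] cells from the start, so the [n] entries
   bring it back to cell 0. *)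
have e0 : (minn n (size w) - n = 0)%N by lia.
case: mo' => [[]|].
- have [ad' [co' ->]] := @sweep_check j r (dec n true w).2 false false fo
    (tape_of (dec n true w).1) (minn n (size w)) row 0 isT.
  rewrite hr e0 /= -[X in adj_in X]subr0 adj_inE hr.
  exists (fo || [&& (j < n)%N, is_one (row j) & common_in j 0 row r]), row.
  split=> //; exists (dec n true w).2, ad', co', n; split=> //.
  by rewrite leq0n add0n /= -andbA.
- have [ad' [co' [row' [-> hk]]]] := @sweep_record j r (dec n true w).2 false false fo
    (tape_of (dec n true w).1) (minn n (size w)) row 0.
  rewrite hr e0 /=; exists fo, row'; split.
    by exists (dec n true w).2, ad', co', n; split.
  by split=> // k kn; rewrite hk hr /= kn subn0 eqz_nat eq_sym.
- have [ad' [co' ->]] := @sweep_search j r (dec n true w).2 false false fo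
    (tape_of (dec n true w).1) (minn n (size w)) row 0.
  rewrite hr e0 /=; exists fo, row; split=> //.
  by exists (dec n true w).2, ad', co', n; split.
Qed.

(** * From the rows to triangles: soundness and completeness *)

Fixpoint do_rows (n j : nat) (rows : seq (seq bool)) (s : astate) : astate :=
  if rows is r :: rows' then do_rows n j.+1 rows' (do_row n j r s) else s.

Lemma read_rows n j rows s :
  foldl read (None, s) (rows_ops n j rows) = (None, do_rows n j rows s).
Proof.
elim: rows j s => //= r rows IH j s.
by rewrite !foldl_cat read_columns read_row_ops IH.
Qed.

Lemma do_rows_ind n (R : nat -> seq bool) (I : nat -> astate -> Prop) s :
  (forall j s, (j < n)%N -> I j s -> I j.+1 (do_row n j (R j) s)) ->
  I 0%N s -> I n (do_rows n 0 [seq R j | j <- iota 0 n] s).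
Proof.
move=> hI; suff H m j s' : (j + m)%N = n -> I j s' ->
    I n (do_rows n j [seq R i | i <- iota j m] s') by exact: H.
elim: m j s' => [|m IH] j s' /=; first by rewrite addn0 => ->.
by move=> e h; apply: IH; [lia|apply: hI => //; lia].
Qed.

Definition mat_rows (n : nat) (A : nat -> nat -> bool) : seq (seq bool) :=
  [seq [seq A i k | k <- iota 0 n] | i <- iota 0 n].

Definition mat_triangle (n : nat) (A : nat -> nat -> bool) : Prop :=
  exists i j k, [/\ (i < n)%N, (j < n)%N & (k < n)%N] /\ [&& A i j, A j k & A i k].

(** Whatever the oracle word, the row that gets recorded is a genuine row [v] of [A] with a 0 on the
    diagonal; a later row [j] that raises the flag supplies the edges [v j], [j k] and [v k]. *)
Lemma found_sound n A w :
  found (foldl read (astart w) (rows_ops n 0 (mat_rows n A))).2 -> mat_triangle n A.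
Proof.
rewrite read_rows /=.
pose I j s := exists mo fo w row, [/\ row_start n mo fo w row s, fo -> mat_triangle n A
  & mo <> None -> exists v, [/\ (v < j)%N, (v < n)%N & forall k, (k < n)%N ->
      is_one (row k) = (k != v) && A v k]].
suff : I n (do_rows n 0 (mat_rows n A) (astart w).2).
  by move=> [mo [fo [w' [row [[bo [ad [co [rh [_ ->]]]]] h _]]]]].
apply: do_rows_ind; last first.
  by exists None, false, w, (tape_of [::]); split=> //; exists false, false, false, 0%N.
move=> j s jn [mo [fo [w' [row [h1 h2 h3]]]]].
have sr : size [seq A j k | k <- iota 0 n] = n by rewrite size_map size_iota.
have [|fo' [row' [h4]]] := @do_row_start n j _ mo fo w' row s _ sr h1; first by lia.
case e : next_mode => [[]|] h5; do 4 eexists; split; try exact: h4; rewrite ?e //.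
- case: h5 => _ -> /orP[/h2//|/and3P[_ h6]].
  rewrite -[X in common_in X]subr0 => /common_inP[k /and5P[_ kn kj]].
  rewrite add0n sr in kn; rewrite subn0 (nth_map 0%N) ?size_iota // nth_iota //.
  have [|v [vj vn hv]] := h3 _; first by move=> m0; move: e; rewrite m0 /=; case: ifP.
  rewrite hv // hv // add0n in h6 *; move=> a1 /andP[_ a2]; case/andP: h6 => _ a3.
  by exists v, j, k; rewrite a1 a2 a3.
- case: h5 => -> _ _.
  have [|v [vj vn hv]] := h3 _; first by move=> m0; move: e; rewrite m0 /=; case: ifP.
  by exists v; split=> //; exact: ltnW.
- by case: h5 => ->.
- case: h5 => _ h6 _; exists j; split=> // k kn.
  by rewrite h6 // (nth_map 0%N) ?size_iota // nth_iota.
- by rewrite h5.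
Qed.

(** On reaching row [j <= v] the oracle word has value [v - j], so the decrement underflows for the
    first time at row [v]. Row [i] then finds the edge to [v] and the common neighbour [k]. *)
Lemma found_complete n (A : nat -> nat -> bool) v i k w :
  (v < i)%N -> (i < n)%N -> (k < n)%N -> k != v -> k != i ->
  A v i -> A i k -> A v k -> bits_val w = v ->
  found (foldl read (astart w) (rows_ops n 0 (mat_rows n A))).2.
Proof.
move=> vi iN kn kv ki a1 a2 a3 hw.
rewrite read_rows /=.
pose I j s := exists mo fo w row, row_start n mo fo w row s /\
  [/\ (j <= v)%N -> mo = None /\ bits_val w = (v - j)%N,
      (v < j)%N -> mo <> None /\ forall k, (k < n)%N ->
        is_one (row k) = (k != v) && A v k
    & (i < j)%N -> fo].
suff : I n (do_rows n 0 (mat_rows n A) (astart w).2).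
  move=> [mo [fo [w' [row [[bo [ad [co [rh [_ ->]]]]] [_ _ h]]]]]].
  exact: h.
apply: do_rows_ind; last first.
  exists None, false, w, (tape_of [::]); split.
    by exists false, false, false, 0%N.
  by rewrite hw subn0; split.
move=> j s jn [mo [fo [w' [row [h1 [h2 h3 h4]]]]]].
have sr : size [seq A j k | k <- iota 0 n] = n by rewrite size_map size_iota.
have [|fo' [row' [h5]]] := @do_row_start n j _ mo fo w' row s _ sr h1; first by lia.
case: (ltngtP v j) => vj.
- have [nm hv] := h3 vj.
  have em : next_mode mo (dec n true w').2 = Some true by case: (mo) nm.
  rewrite em in h5 *.
  move=> [er ef]; do 4 eexists; split; first exact: h5.
  split=> [|_|ij]; first by lia.
    by rewrite er; split=> //; exact: hv.
  rewrite ef; have [ij'|ij'] := ltnP i j; first by rewrite h4.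
  have ej : j = i by lia.
  subst j; rewrite hv // a1 iN (_ : i != v) /=; last by lia.
  rewrite orbC -[X in common_in X]subr0; apply/orP; left; apply/common_inP.
  exists k; rewrite sr kn ki subn0 (nth_map 0%N) ?size_iota // nth_iota // add0n a2.
  by rewrite hv // kv a3.
- have [em ew] := h2 (ltnW vj).
  (* The value is at most [v], and [v < n < 2 ^ n]. *)
  have [|d1 d2] := @dec_val n true w'.
    by rewrite ew (leq_ltn_trans _ (ltn_expl n (ltnSn 1))) //; lia.
  have d1' : (dec n true w').2 = false by rewrite d1 ew; lia.
  move: h5; rewrite em d1' /= => h5 _; do 4 eexists; split; first exact: h5.
  split=> [jv||]; [|lia|lia].
  by split=> //; rewrite d2 ew //=; lia.
- have [|em ew] := h2; first by rewrite vj.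
  have [|d1 d2] := @dec_val n true w'.
    by rewrite ew (leq_ltn_trans _ (ltn_expl n (ltnSn 1))) //; lia.
  have d1' : (dec n true w').2 = true by rewrite d1 ew; lia.
  move: h5; rewrite em d1' /= => h5 [_ h6]; do 4 eexists; split; first exact: h5.
  split=> [|_|]; [lia| |lia].
  split=> // k' kn'; rewrite h6 // (nth_map 0%N) ?size_iota // nth_iota //.
  by rewrite vj.
Qed.

Lemma tri_correct n (A : nat -> nat -> bool) l :
  (forall i j, A i j = A j i) -> (forall i, ~~ A i i) ->
  (n <= 2 ^ l)%N ->
  (exists w : l.-tuple bool, tm_accepts tri_tm (rows_ops n 0 (mat_rows n A)) w) <->
  mat_triangle n A.
Proof.
move=> sA iA nl; split=> [[w /tri_accepts]|[i [j [k [[iN jN kN] /and3P[a1 a2 a3]]]]]].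
  exact: found_sound.
have ne u v : A u v -> u != v by apply: contraTneq => ->.
(* By symmetry the oracle may name the smaller of two vertices; the third one only has to differ
   from both, wherever it stands in the order. *)
wlog ij : i j iN jN a1 a2 a3 / (i < j)%N.
  move=> H; case: (ltngtP i j) => ij; first exact: (H i j).
    by apply: (H j i) => //; rewrite sA.
  by move: (ne _ _ a1); rewrite ij eqxx.
have [|w sw ew] := @exists_bits l i; first exact: leq_trans nl.
exists (tcast sw (in_tuple w)); rewrite val_tcast /=; apply/tri_accepts.
apply: (@found_complete n A i j k) => //; rewrite eq_sym; exact: ne.
Qed.

(** * Inputs have to be read *)

(** State [None] is still running; [Some b] has halted with verdict [b]. *)
Definition all_trans (q : option bool) (a : {ffun 'I_2 -> letter}) :
    option bool * {ffun 'I_2 -> letter * move} :=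
  (match a ord0 with
   | Some (inl true) => None
   | None => Some true
   | _ => Some false
   end, [ffun k => (a k, if k == ord0 then MoveR else Stay)]).

Definition all_tm : tm :=
  @Tm 0 (option bool) void None (fun q => q != None) (fun q => q == Some true) all_trans.

Lemma all_run x w t : (t <= size x)%N ->
  let c := tm_run all_tm x w t in
  if all id (take t x) then
    [/\ tmc_state c = None, tmc_head c ord0 = t & tmc_tape c ord0 = tape_of x]
  else tmc_state c = Some false.
Proof.
elim: t => [_|t IH ht] /=; first by rewrite take0.
rewrite (take_nth false ht) all_rcons.
have {IH} /= := IH (ltnW ht); rewrite -/(tm_run all_tm x w t) /tm_step.
set c := tm_run all_tm x w t.
case: (all id (take t x)) => [[hs hh ht']|hs]; last by rewrite andbF hs.
have hx : tmc_tape c ord0 t = Some (inl (nth false x t)).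
  rewrite ht' /tape_of -odflt_onth; have : onth x t by rewrite onthTE.
  by case: (onth x t).
rewrite hs /= /all_trans ffunE hh hx andbT; case: ifP => -> //=.
split=> //; first by rewrite ffunE.
by rewrite !ffunE /= ?hh eta_id ht'.
Qed.

Lemma all_end x w : tmc_state (tm_run all_tm x w (size x).+1) = Some (all id x).
Proof.
rewrite /tm_run iterS -/(tm_run all_tm x w (size x)) /tm_step.
have := all_run w (leqnn (size x)); rewrite take_size /=.
set c := tm_run all_tm x w _.
case: (all id x) => [[hs hh ht]|hs]; last by rewrite hs /= hs.
by rewrite hs /= /all_trans ffunE hh ht /tape_of onth_default.
Qed.

Lemma all_halts x w : tm_halts_in all_tm x w (size x).+1.
Proof. by rewrite /tm_halts_in all_end. Qed.

Lemma all_accepts x w : tm_accepts all_tm x w <-> all id x.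
Proof.
by rewrite (tm_acceptsE (all_halts x w)) all_end /=; case: (all id x).
Qed.

(** Relates two runs after [t] steps, on inputs differing at position [m] only. Heads advance by at
    most one cell per step, so the difference stays unseen as long as [t < m]. *)
Definition same_upto (M : tm) (m t : nat) (c c' : tm_config M) : Prop :=
  [/\ tmc_state c = tmc_state c', tmc_head c = tmc_head c',
      forall k, (tmc_head c k <= t)%N &
      forall k pos, (k != ord0) || (pos != m) -> tmc_tape c k pos = tmc_tape c' k pos].

Lemma same_upto_step (M : tm) m t (c c' : tm_config M) : (t < m)%N ->
  same_upto m t c c' -> same_upto m t.+1 (tm_step c) (tm_step c').
Proof.
move=> tm [hs hh hl ht]; rewrite /tm_step -hs -hh.
case: ifP => _; first by split=> // k; apply: leqW.
have -> : [ffun k => tmc_tape c' k (tmc_head c k)] =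
    [ffun k => tmc_tape c k (tmc_head c k)].
  apply/ffunP => k; rewrite !ffunE ht //; apply/orP; right.
  by have := hl k; lia.
case: tm_trans => q act; split=> // [k|k pos h] /=.
  by have := hl k; case: (act k).2 => /=; lia.
by case: ifP => // _; apply: ht.
Qed.

(* A machine halting in less than [n] steps cannot read the last letter. *)
Lemma all_lower_bound (M : tm) (T : nat -> nat) :
  (forall x, tm_halts_in M x [::] (T (size x))) ->
  (forall x, all id x <-> tm_accepts M x [::]) ->
  forall n, (0 < n)%N -> (n <= T n)%N.
Proof.
move=> hT hL [//|n] _; rewrite leqNgt; apply/negP => lt.
pose x b := rcons (nseq n true) b.
have sx b : size (x b) = n.+1 by rewrite size_rcons size_nseq.
have same t : (t <= n)%N -> same_upto n t (tm_run M (x true) [::] t)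
    (tm_run M (x false) [::] t).
  elim: t => [_|t IH ht].
    split=> // k pos /=; case: k => -[|k] hk //=.
    rewrite /x -!cats1 !onth_cat size_nseq => ne.
    by case: ltngtP => // [lt'|e]; [rewrite !onth_default //=; lia|rewrite e eqxx in ne].
  by rewrite /tm_run !iterS; apply: same_upto_step => //; apply: IH; lia.
have := hL (x true); have := hL (x false).
rewrite (tm_acceptsE (hT _)) (tm_acceptsE (hT (x true))) !sx.
have [|-> _ _ _] := same (T n.+1); first by lia.
move=> h1 h2; suff : all id (x false) by rewrite all_rcons.
by apply/h1/h2; rewrite all_rcons /= all_nseq orbT.
Qed.

(** * Asymptotics *)

Lemma time_OP (R : realType) (T : nat -> nat) (g : nat -> R) :
  time_O T g <-> exists (K : R) (n0 : nat), 0 < K /\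
    forall n, (n0 <= n)%N -> (T n)%:R <= K * `|g n|.
Proof.
split=> [/eqO_exP[K K0 [n0 _ h]]|[K [n0 [K0 h]]]].
  by exists K, n0; split=> // n /h /=; rewrite normr_nat.
apply/eqO_exP; exists K => //; exists n0 => // n /h /=.
by rewrite normr_nat.
Qed.

Lemma powR_unbounded (R : realType) (K c : R) : 0 < c ->
  exists n0 : nat, forall n, (n0 <= n)%N -> K < n%:R `^ c.
Proof.
move=> c0; pose a : R := (`|K| + 1) `^ c^-1.
have a0 : 0 <= a by exact: powR_ge0.
exists (Num.truncn a).+1 => n hn.
have an : a <= n%:R.
  by apply: le_trans (ltW (truncnS_gt a)) _; rewrite ler_nat.
apply: (@lt_le_trans _ _ (`|K| + 1)); first by have := ler_norm K; lra.
have -> : `|K| + 1 = a `^ c.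
  by rewrite /a -powRrM mulVf ?gt_eqF // powRr1 // addr_ge0.
by apply: ge0_ler_powR => //; rewrite ?nnegrE // ltW.
Qed.

Lemma not_sublinear (R : realType) (T : nat -> nat) (c : R) : c < 1 ->
  time_O T (fun n => n%:R `^ c) -> ~ (forall n, (0 < n)%N -> (n <= T n)%N).
Proof.
move=> c1 /time_OP[K [n0 [K0 hK]]] h.
have [|n1 hn1] := @powR_unbounded R K (1 - c); first by lra.
pose n := (n0 + n1).+1.
have n_gt0 : 0 < n%:R :> R by rewrite ltr0n.
have := hn1 n; rewrite ltNge => /(_ _)/negP; apply; first by rewrite /n; lia.
have : n%:R <= K * n%:R `^ c.
  apply: (@le_trans _ _ (T n)%:R); first by rewrite ler_nat h.
  have := hK n; rewrite ger0_norm ?powR_ge0 //; apply; rewrite /n; lia.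
have e : n%:R = n%:R `^ (1 - c) * n%:R `^ c :> R.
  by rewrite -powRD ?subrK ?powRr1 ?ler0n // pnatr_eq0 implybT.
by rewrite {1}e ler_pM2r // powR_gt0.
Qed.

(** With [l] the truncated logarithm, [ln y < y] at y = (2^l)^eta bounds [l] by m^eta / (eta ln 2);
    the extra 1 in the constant pays for the successor in [log_size]. *)
Lemma log_size_powR (R : realType) (eta : R) : 0 < eta ->
  exists2 B : R, 0 < B & forall m : nat, (0 < m)%N ->
    (log_size m)%:R <= B * m%:R `^ eta.
Proof.
move=> e0; have l2 : 0 < ln 2 :> R by rewrite ln_gt0 // ltr1n.
exists ((eta * ln 2)^-1 + 1) => [|m m0].
  by rewrite addr_gt0 // invr_gt0 mulr_gt0.
rewrite /log_size absz_nat; set l := trunc_log 2 m.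
have hl : (2 ^ l <= m)%N by apply: trunc_logP.
have m1 : 1 <= m%:R `^ eta :> R.
  by rewrite -[leLHS](powRr0 m%:R) ler_powR ?ler1n // ltW.
have : l%:R * (eta * ln 2) <= m%:R `^ eta.
  apply: le_trans (_ : ln (((2 ^ l)%N%:R : R) `^ eta) <= _).
    by rewrite ln_powR natrX lnXn // mulrCA mulr_natl.
  apply: le_trans (ltW (ln_sublinear _)) _.
    by rewrite powR_gt0 // ltr0n expn_gt0.
  by rewrite ge0_ler_powR ?nnegrE ?ler0n ?ler_nat // ltW.
rewrite -ler_pdivlMr ?mulr_gt0 // mulrDl mul1r -[l.+1%:R]natr1 => h.
by rewrite lerD // mulrC.
Qed.

(** Raising 2 to half the binary logarithm of [n] gives the square root of [n], which is at least
    [N]. *)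
Lemma ceil_half_log2_bound (R : realType) (n N : nat) :
  (N ^ 2 <= n)%N -> (0 < N)%N -> (N <= 2 ^ ceil_half_log2 R n)%N.
Proof.
move=> hn N0; rewrite /ceil_half_log2; set y : R := 2^-1 * _.
have l2 : 0 < ln 2 :> R by rewrite ln_gt0 // ltr1n.
have n0 : (0 < n)%N by apply: leq_trans hn; rewrite expn_gt0 N0.
have hy : ln N%:R <= y * ln 2.
  rewrite /y -mulrA mulfVK ?gt_eqF // mulrC ler_pdivlMr //.
  have -> : ln N%:R * 2 = ln ((N ^ 2)%N%:R : R).
    by rewrite natrX lnXn ?ltr0n // mulr_natr.
  by rewrite ler_ln ?posrE ?ltr0n ?expn_gt0 ?N0 // ler_nat.
have ly : y <= (`|Num.ceil y|%N)%:R.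
  by apply: le_trans (ceil_ge _) _; rewrite pmulrn ler_int abszE ler_norm.
rewrite -(ler_nat R) -ler_ln ?posrE ?ltr0n ?expn_gt0 // natrX lnXn //.
apply: le_trans hy _; rewrite -[leRHS]mulr_natl ler_pM2r //.
Qed.

(** Both summands are O(n^d'): the quadratic one since [2 <= d'], the other since [T] is taken at
    4n^2 with exponent d'/2. The logarithm is absorbed by n^(d - d'). *)
Lemma simulation_cost (R : realType) (T : nat -> nat) (C : nat) (d' d : R) :
  2 <= d' -> d' < d -> time_O T (fun n => n%:R `^ (d' / 2)) ->
  time_O (fun n => C * (n.+1 ^ 2 + T (4 * n * n)) *
    log_size (C * (n.+1 ^ 2 + T (4 * n * n)))%N)%N (fun n => n%:R `^ d).
Proof.
move=> hd' hd /time_OP[K [n0 [K0 hK]]].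
(* Chosen so that n^d' raised to the power [eta] is n^(d - d'). *)
pose eta := (d - d') / d'.
have eta0 : 0 < eta by rewrite divr_gt0 //; lra.
have [B B0 hB] := log_size_powR eta0.
(* The 4 comes from (n+1)^2 <= 4n^2 and the other term from (4n^2)^(d'/2). Using [C.+1] keeps [A]
   and the argument of the logarithm positive even if [C] is 0. *)
pose A := C.+1%:R * (4 + K * 4 `^ (d' / 2)).
have A0 : 0 < A.
  by rewrite mulr_gt0 ?ltr0n // addr_gt0 // mulr_gt0 // powR_gt0.
apply/time_OP; exists (A * (B * A `^ eta)), (n0 + 1)%N.
split=> [|n hn]; first by rewrite mulr_gt0 // mulr_gt0 // powR_gt0.
have n1 : (0 < n)%N by lia.
have n1R : 1 <= n%:R :> R by rewrite ler1n.
set m := (n.+1 ^ 2 + T (4 * n * n))%N.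
have m0 : (0 < m)%N by rewrite addn_gt0 expn_gt0.
have nd : 0 < n%:R `^ d' :> R by rewrite powR_gt0 // ltr0n.
have hm : C.+1%:R * m%:R <= A * n%:R `^ d'.
  rewrite /A -mulrA ler_pM2l ?ltr0n // /m natrD mulrDl lerD //.
    apply: (@le_trans _ _ (4 * n%:R `^ 2)); last by rewrite ler_pM2l // ler_powR.
    rewrite -[2]/(2%:R) powR_mulrn ?ler0n // -natrX -natrM ler_nat.
    by rewrite -(expnMn 2 n 2) leq_exp2r //; lia.
  apply: le_trans (hK _ _) _; first by nia.
  rewrite ger0_norm ?powR_ge0 // -mulrA ler_pM2l // -mulnA natrM natrM.
  rewrite powRM ?mulr_ge0 ?ler0n // ler_pM2l ?powR_gt0 //.
  rewrite -expr2 -powR_mulrn ?ler0n // -powRrM.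
  by rewrite (_ : 2%:R * (d' / 2) = d') //; field.
rewrite ger0_norm ?powR_ge0 // natrM.
have e : n%:R `^ d = n%:R `^ d' * n%:R `^ (d - d') :> R.
  by rewrite -powRD ?(addrC d') ?subrK // pnatr_eq0 (gtn_eqF n1) implybT.
have hCm : (C * m)%:R <= A * n%:R `^ d' :> R.
  by apply: le_trans hm; rewrite -natrM ler_nat leq_mul2r leqnSn orbT.
have hL : (log_size (C * m)%N)%:R <= B * (A `^ eta * n%:R `^ (d - d')) :> R.
  apply: le_trans (_ : (log_size (C.+1 * m)%N)%:R <= _).
    by rewrite ler_nat leq_log_size // absz_nat leq_mul2r leqnSn orbT.
  apply: le_trans (hB _ _) _; first by rewrite muln_gt0.
  rewrite ler_pM2l //.
  have -> : n%:R `^ (d - d') = (n%:R `^ d') `^ eta :> R.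
    by rewrite -powRrM /eta mulrC mulfVK //; lra.
  rewrite -powRM ?(ltW A0) ?powR_ge0 //.
  rewrite natrM ge0_ler_powR ?(ltW eta0) //.
    by rewrite nnegrE mulr_ge0 ?ler0n.
  by rewrite nnegrE mulr_ge0 ?(ltW A0) ?powR_ge0.
rewrite e; apply: le_trans (ler_pM _ _ hCm hL) _; rewrite ?ler0n //.
by rewrite le_eqVlt; apply/orP; left; apply/eqP; ring.
Qed.

(** * The reduction from triangle detection *)

Definition adjacency (N : nat) (e : rel 'I_N) (i j : nat) : bool :=
  if insub i is Some u then if insub j is Some v then e u v else false else false.

Lemma adjacencyE (N : nat) (e : rel 'I_N) (i j : 'I_N) : adjacency e i j = e i j.
Proof. by rewrite /adjacency !valK. Qed.

Lemma graph_inputE (N : nat) (e : rel 'I_N) :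
  graph_input e = N%:Z :: int_of_bits (flatten (mat_rows N (adjacency e))).
Proof.
congr cons; rewrite /int_of_bits map_flatten /mat_rows -val_enum_ord -!map_comp.
congr flatten; apply: eq_map => i /=; rewrite -!map_comp; apply: eq_map => j /=.
by rewrite adjacencyE.
Qed.

Lemma mat_triangleE (N : nat) (e : rel 'I_N) :
  mat_triangle N (adjacency e) <-> has_triangle e.
Proof.
split=> [[i [j [k [[iN jN kN] h]]]]|[i [j [k h]]]]; last first.
  by exists i, j, k; rewrite !adjacencyE !ltn_ord.
exists (Ordinal iN), (Ordinal jN), (Ordinal kN).
by rewrite -!adjacencyE.
Qed.

Lemma time_O_succ (R : realType) : time_O succn (fun n => n%:R : R).
Proof.
apply/time_OP; exists 2, 1%N; split=> // n n1.
by rewrite normr_nat -natrM ler_nat; lia.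
Qed.

Lemma in_NDTIME (R : realType) (f : nat -> nat) (M : tm) :
  (forall x w, tm_halts_in M x w (size x).+1) ->
  NDTIME f (fun n => n%:R : R) (fun x => exists w : (f (size x)).-tuple bool,
    tm_accepts M x w).
Proof. by move=> h; exists M, succn; split=> //; exact: time_O_succ. Qed.

Lemma DTIME_accepts (M : tm) x :
  (exists w : 0.-tuple bool, tm_accepts M x w) <-> tm_accepts M x [::].
Proof.
by split=> [[w]|h]; [rewrite (tuple0 w)|exists [tuple]].
Qed.

Theorem theorem2 (R : realType) :
  (forall delta : R, delta < omega R -> ~ triangle_in_time delta) ->
  forall delta' : R, 0 < delta' -> delta' < omega R ->
    ~ (NDTIME (ceil_half_log2 R) (fun n : nat => n%:R : R)
         `<=` DTIME (fun n : nat => (n%:R : R) `^ (delta' / 2))).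
Proof.
move=> hyp d' d'0 d'w sub.
have [lt2|ge2] := ltP d' 2.
  have [M [T [hT hhalt hacc]]] := sub _ (in_NDTIME R (ceil_half_log2 R) all_halts).
  apply: (not_sublinear _ hT); first by lra.
  apply: (@all_lower_bound M) => x; first exact: (hhalt x [tuple]).
  rewrite -DTIME_accepts -hacc; split=> [h|[w /all_accepts//]].
  (* [all_tm] ignores its oracle, so any string of the right length witnesses acceptance. *)
  by exists [tuple of nseq _ false]; apply/all_accepts.
have [M [T [hT hhalt hacc]]] := sub _ (in_NDTIME R (ceil_half_log2 R) tri_halts).
have [p [C hp]] := ram_simulates M.
(* The midpoint is below [omega R], as the hypothesis demands, and above [d'], which leaves room for
   the logarithm. *)
pose d := (d' + omega R) / 2.
apply: (hyp d); first by rewrite /d; lra.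
exists p, (fun n => C * (n.+1 ^ 2 + T (4 * n * n)) *
    log_size (C * (n.+1 ^ 2 + T (4 * n * n)))%N)%N, (fun=> 0); split.
- move=> N e [sym irr]; pose A := adjacency e.
  have sA i j : A i j = A j i.
    by rewrite /A /adjacency; do 2 case: insub => // *; apply: sym.
  have iA i : ~~ A i i by rewrite /A /adjacency; case: insub => // u; rewrite irr.
  have sr : size (mat_rows N A) = N by rewrite size_map size_iota.
  have ar : all (fun r => size r == N) (mat_rows N A).
    by rewrite all_map; apply/allP => i _ /=; rewrite size_map size_iota.
  have sx : size (rows_ops N 0 (mat_rows N A)) = (4 * N * N)%N.
    by rewrite size_rows_ops // sr.
  have halt : tm_halts_in M (rows_ops N 0 (mat_rows N A)) [::] (T (4 * N * N)%N).
    by rewrite -sx; apply: (hhalt _ [tuple]).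
  have [t [b [hr ht hb]]] := hp N _ _ sr ar halt.
  exists t, [:: (b : nat)%:Z]; split=> //; first by rewrite graph_inputE.
  rewrite -mat_triangleE -(@tri_correct _ _ (ceil_half_log2 R (4 * N * N)) sA iA).
    have /= := hacc (rows_ops N 0 (mat_rows N A)); rewrite sx DTIME_accepts -hb => ->.
    by case: b {hr hb}; split.
  (* The case [N = 0] is immediate; otherwise 4N^2 >= N^2 makes the oracle string long enough to
     name any vertex. *)
  case: N {e sym irr A sA iA sr ar sx halt hr ht hb} => // N.
  by apply: ceil_half_log2_bound => //; lia.
- exact: cvg_cst.
- have d'd : d' < d by rewrite /d; lra.
  have /time_OP[K [n0 [K0 h]]] := simulation_cost C ge2 d'd hT; apply/time_OP.
  by exists K, n0; split=> // n /h; rewrite addr0.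
Qed.
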